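(* Let $p\in(1,\infty)$, $q\in[1,p)$, $s\in\mathbb{Z}_+$ and $\alpha\in[0,\infty)$, and let $\mathcal{X}$ be $\mathbb{R}^n$ or a cube $Q_0\subsetneqq\mathbb{R}^n$. Then $jn_{(p,q,s)_{\alpha}}(\mathcal{X})=jn_{(p,1,s)_{\alpha}}(\mathcal{X})$ with equivalent norms.
   Context: $\mathbb{Z}_+=\{0,1,2,\dots\}$. A cube $Q\subset\mathbb{R}^n$ has edges parallel to the coordinate axes and finite positive side length $\ell(Q)$, and is not necessarily closed; $\ell(\mathbb{R}^n):=\infty$. $\fint_Q f:=\frac1{|Q|}\int_Q f$. Functions are measurable and identified when equal almost everywhere. $L^q_{\mathrm{loc}}(\mathcal{X})$ is the set of measurable $f$ with $f\mathbf{1}_E\in L^q(\mathcal{X})$ for every bounded $E\subset\mathcal{X}$. For $f\in L^1(Q)$, $P^{(s)}_Q(f)$ is the unique polynomial on $Q$ of degree at most $s$ with $\int_Q[f(x)-P^{(s)}_Q(f)(x)]x^\beta\,dx=0$ for all $\beta\in\mathbb{Z}_+^n$, $|\beta|\le s$. Fix $c_0\in(0,\ell(\mathcal{X}))$. Let $P^{(s)}_{Q,c_0}(f):=P^{(s)}_Q(f)$ if $\ell(Q)<c_0$ and $P^{(s)}_{Q,c_0}(f):=0$ if $\ell(Q)\ge c_0$. $jn_{(p,q,s)_\alpha}(\mathcal{X})$ is the set of all $f\in L^q_{\mathrm{loc}}(\mathcal{X})$ with $$\|f\|_{jn_{(p,q,s)_\alpha}(\mathcal{X})}:=\sup\Big[\sum_{j}|Q_j|\Big\{|Q_j|^{-\alpha}\Big[\fint_{Q_j}|f-P^{(s)}_{Q_j,c_0}(f)|^q\Big]^{1/q}\Big\}^p\Big]^{1/p}<\infty,$$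 the supremum being over all countable (finite or infinite) collections $\{Q_j\}_j$ of cubes in $\mathcal{X}$ with pairwise disjoint interiors. *)

(* Defs.v *)
From HB Require Import structures.
From mathcomp Require Import all_boot all_order all_algebra.
From mathcomp Require Import all_classical all_reals all_analysis.
From mathcomp.multinomials Require mpoly.
(* The notations and names of mpoly clash with those of MathComp-Analysis. *)
Import (canonicals, coercions) mpoly.

Set Implicit Arguments.
Unset Strict Implicit.
Unset Printing Implicit Defensive.

Import Order.TTheory GRing.Theory Num.Theory.
Import numFieldNormedType.Exports.

Local Open Scope classical_set_scope.
Local Open Scope ring_scope.

(* R^n, with its Borel sigma-algebra (generated by the coordinates). *)
Notation euclid R n := (n.-tuple (measurableTypeR R)).

Definition coord {R : realType} {n : nat} (x : euclid R n) (i : 'I_n) : R :=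
  tnth x i.

Section lebesgue_n_step.
Context {R : realType} {n : nat}.
Variable m : {sigma_finite_measure set (euclid R n) -> \bar R}.

Definition tuple_cons (u : measurableTypeR R * euclid R n) : euclid R n.+1 :=
  [tuple of u.1 :: u.2].

Definition lebesgue_n_step : set (euclid R n.+1) -> \bar R :=
  pushforward (lebesgue_measure \x m)%E tuple_cons.

Lemma measurable_tuple_cons : measurable_fun setT tuple_cons.
Proof. exact: measurable_cons. Qed.

Let step0 : lebesgue_n_step set0 = 0%E.
Proof. by rewrite /lebesgue_n_step /pushforward preimage_set0 measure0. Qed.

Let step_ge0 A : (0 <= lebesgue_n_step A)%E.
Proof. have mf := measurable_tuple_cons; exact: measure_ge0. Qed.

Let step_sigma_additive : semi_sigma_additive lebesgue_n_step.
Proof. have mf := measurable_tuple_cons; exact: measure_semi_sigma_additive. Qed.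

HB.instance Definition _ := isMeasure.Build _ _ _ lebesgue_n_step
  step0 step_ge0 step_sigma_additive.

Definition tuple_uncons (x : euclid R n.+1) : measurableTypeR R * euclid R n :=
  (thead x, [tuple of behead x]).

Lemma measurable_tuple_uncons : measurable_fun setT tuple_uncons.
Proof.
apply: measurable_fun_pair; last exact: measurable_behead.
exact: measurable_tnth.
Qed.

Lemma tuple_consK : cancel tuple_cons tuple_uncons.
Proof. by case=> a t; congr pair; apply/val_inj. Qed.

Lemma tuple_unconsK : cancel tuple_uncons tuple_cons.
Proof. by move=> x; rewrite [RHS]tuple_eta. Qed.

Let step_sigma_finite : sigma_finite setT lebesgue_n_step.
Proof.
have /sigma_finiteP[G [TG ndG Goo]] := sigma_finiteT m.
have /sigma_finiteP[F [TF ndF Foo]] := sigma_finiteT (@lebesgue_measure R).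
have mFG k : measurable (F k `*` G k).
  by apply: measurableX; [exact: (Foo k).1|exact: (Goo k).1].
exists (fun k => tuple_uncons @^-1` (F k `*` G k)).
  rewrite -preimage_bigcup (_ : \bigcup_k _ = setT) ?preimage_setT//.
  rewrite -subTset => -[x y] _.
  have [i _ Fix] : (\bigcup_k F k) x by rewrite -TF.
  have [j _ Gjy] : (\bigcup_k G k) y by rewrite -TG.
  exists (maxn i j) => //; split.
    by move: x Fix; exact/subsetPset/ndF/leq_maxl.
  by move: y Gjy; exact/subsetPset/ndG/leq_maxr.
move=> k; split.
  by rewrite -[X in measurable X]setTI; exact: measurable_tuple_uncons.
rewrite /lebesgue_n_step /pushforward -comp_preimage.
rewrite (_ : _ \o _ = id); last by apply/funext => u; exact: tuple_consK.
have [? ?] := Foo k; have [? ?] := Goo k.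
by rewrite preimage_id product_measure1E// lte_mul_pinfty// ge0_fin_numE.
Qed.

HB.instance Definition _ := Measure_isSigmaFinite.Build _ _ _ lebesgue_n_step
  step_sigma_finite.

End lebesgue_n_step.

(* n-dimensional Lebesgue measure on the Borel sets, as the iterated product of
   the one-dimensional one; lebesgue_n_box determines it uniquely. *)
Fixpoint lebesgue_n {R : realType} (n : nat) :
    {sigma_finite_measure set (euclid R n) -> \bar R} :=
  match n with
  | 0 => \d_([tuple] : euclid R 0)
  | n'.+1 => lebesgue_n_step (lebesgue_n n')
  end.

Lemma lebesgue_n_box {R : realType} (n : nat)
    (A : 'I_n -> set (measurableTypeR R)) :
  (forall i, measurable (A i)) ->
  lebesgue_n n [set x | forall i, A i (coord x i)]
  = (\prod_(i < n) lebesgue_measure (A i))%E.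
Proof.
elim: n A => [|n IH] A mA.
  rewrite big_ord0 /= diracE mem_set//; by case.
rewrite big_ord_recl -IH => [|i]; last exact: mA.
rewrite -product_measure1E//; last first.
  rewrite (_ : mkset _ = \bigcap_(i in setT)
      ((fun x => tnth x i) @^-1` A (lift ord0 i))); last first.
    by apply/seteqP; split => x Ax i//=; exact: Ax.
  apply: fin_bigcap_measurable => // i _.
  by rewrite -[X in measurable X]setTI; exact: measurable_tnth.
congr (product_measure1 _ _ _); apply/seteqP; split=> -[a t] /=.
  move=> At; split=> [|i]; first exact: (At ord0).
  by have := At (lift ord0 i); rewrite /coord/= tnthS.
move=> [Aa At] i; have [j ->|->//] := unliftP ord0 i.
by rewrite /coord tnthS; exact: At.
Qed.

(* side is the edge length; each of the 2n faces may be included or not. *)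
Record cube (R : realType) (n : nat) := Cube {
  corner : 'I_n -> R;
  side : R;
  side_gt0 : 0 < side;
  lclosed : 'I_n -> bool;
  rclosed : 'I_n -> bool
}.

Inductive domain (R : realType) (n : nat) :=
  | WholeSpace
  | CubeDomain of cube R n.
Arguments WholeSpace {R n}.

Section localized_JNC.
Context {R : realType} {n : nat}.
Local Notation mu := (@lebesgue_n R n).
Implicit Types (Q : cube R n) (X : domain R n) (f : euclid R n -> R).

Definition edge Q (i : 'I_n) : interval R :=
  Interval (BSide (lclosed Q i) (corner Q i))
           (BSide (~~ rclosed Q i) (corner Q i + side Q)).

Definition set_of_cube Q : set (euclid R n) :=
  [set x | forall i, coord x i \in edge Q i].

Definition set_of_domain X : set (euclid R n) :=
  if X is CubeDomain Q0 then set_of_cube Q0 else setT.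

Definition domain_side X : \bar R :=
  if X is CubeDomain Q0 then (side Q0)%:E else +oo%E.

(* Topological interior; tuples carry no topology in the library. *)
Definition euclid_interior (A : set (euclid R n)) : set (euclid R n) :=
  [set x | exists2 e : R, 0 < e &
    forall y, (forall i, `|coord y i - coord x i| < e) -> A y].

Definition euclid_bounded (A : set (euclid R n)) : Prop :=
  exists M : R, forall x, A x -> forall i, `|coord x i| <= M.

Definition cube_vol Q : R := fine (mu (set_of_cube Q)).

(* Average over Q of a nonnegative extended-real function. *)
Definition cube_mean Q (g : euclid R n -> \bar R) : \bar R :=
  (((cube_vol Q)^-1)%:E * \int[mu]_(x in set_of_cube Q) g x)%E.

(* Elements of a function space on X are represented by total functions whose
   values outside X are irrelevant, and classes modulo a.e. equality by their
   Borel representatives. *)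
Definition Lq_loc X (q : R) : set (euclid R n -> R) :=
  [set f | measurable_fun (set_of_domain X) f /\
    forall E, measurable E -> euclid_bounded E -> E `<=` set_of_domain X ->
      f \_ E \in Lfun mu q%:E].

Definition poly_eval (P : mpoly.mpoly n R) (x : euclid R n) : R :=
  mpoly.meval (coord x) P.

Definition monomial (b : mpoly.multinom n) (x : euclid R n) : R :=
  mpoly.mmap1 (coord x) b.

(* mpoly.msize is one plus the total degree, and 0 for the zero polynomial. *)
Definition is_cube_poly (s : nat) Q f (P : mpoly.mpoly n R) : Prop :=
  (mpoly.msize P <= s.+1)%N /\
  forall b : mpoly.multinom n, (mpoly.mdeg b <= s)%N ->
    (\int[mu]_(x in set_of_cube Q)
       ((f x - poly_eval P x) * monomial b x)%:E = 0)%E.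

(* The polynomial P_Q^(s)(f), which exists and is unique for f integrable on Q;
   the default value 0 is only reached for other f. *)
Definition cube_poly (s : nat) Q f : mpoly.mpoly n R :=
  xget 0 [set P | is_cube_poly s Q f P].

Definition cube_poly_loc (s : nat) (c0 : R) Q f : mpoly.mpoly n R :=
  if side Q < c0 then cube_poly s Q f else 0.

(* A countable collection of cubes is a family indexed by a subset of nat. *)
Definition admissible X (D : set nat) (Q : nat -> cube R n) : Prop :=
  (forall j, D j -> set_of_cube (Q j) `<=` set_of_domain X) /\
  trivIset D (fun j => euclid_interior (set_of_cube (Q j))).

Definition oscillation (q : R) (s : nat) (c0 : R) f Q : \bar R :=
  (cube_mean Q (fun x =>
     (`|f x - poly_eval (cube_poly_loc s c0 Q f) x| `^ q)%:E) `^ q^-1)%E.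

Definition jn_norm X (c0 p q : R) (s : nat) (alpha : R) f : \bar R :=
  ereal_sup [set y | exists D (Q : nat -> cube R n), admissible X D Q /\
    y = ((\esum_(j in D)
            (cube_vol (Q j))%:E *
            ((cube_vol (Q j) `^ (- alpha))%R%:E * oscillation q s c0 f (Q j))
              `^ p) `^ p^-1)%E].

Definition jn X (c0 p q : R) (s : nat) (alpha : R) : set (euclid R n -> R) :=
  [set f | Lq_loc X q f /\ (jn_norm X c0 p q s alpha f < +oo)%E].

End localized_JNC.

(* Main.v *)
(* Fix a cube Q and put a(Q) for the mean of |f - P_Q| over Q. Inside Q, stop at
   the maximal dyadic subcubes Q' on which the mean of |f - P_Q| exceeds 2 a(Q)
   and iterate. The k-th generation of stopping cubes consists of disjoint cubes
   of total measure at most |Q| / 2^k, and almost everywhere |f - P_Q| is at most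
   a constant times the sum of a(Q') over the stopping cubes Q' containing the
   point: between consecutive stopping cubes the polynomial jumps by O(a), since
   |P_Q' g| <= C mean_Q' |g|, and where the iteration halts Lebesgue
   differentiation gives |f - P_Q'| <= 2 a(Q'). As each generation is an
   admissible family, the sum of |Q'| a(Q')^p over it is at most some K^p, so its
   contribution to the L^q norm decays geometrically in k when q < p. This bounds
   the q-term of every cube by the 1-sum of an admissible family inside it, and
   the union of these families over a disjoint family of cubes is admissible. *)
Require Import Defs.
From mathcomp Require Import all_boot all_order all_algebra.
From mathcomp Require Import all_classical all_reals all_analysis.
From mathcomp.multinomials Require mpoly.
From mathcomp Require Import measurable_realfun ring lra zify.
Import (canonicals, coercions) mpoly.
(* [coord] would otherwise denote the coordinates of vector.v. *)
Import Defs.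

Import Order.TTheory GRing.Theory Num.Theory.
Import numFieldNormedType.Exports.
Local Open Scope classical_set_scope.
Local Open Scope ring_scope.
Set Implicit Arguments.
Unset Strict Implicit.
Unset Printing Implicit Defensive.

(** * Polynomials in one variable *)

(** The exponent q is arbitrary in [1, p), so the sum of jumps along a chain of stopping cubes is
    not raised to the power q at once: crossing one stopping cube uses (x + y)^q <= C x^q + tau y^q
    with tau > 1 as close to 1 as desired. A cube of generation k then carries the weight tau^k, and
    tau = 2^(b/2) with b = 1 - q/p leaves the ratio 2^(-b/2) < 1 against the decay 2^(-bk) of the
    generations. The truncation at c0 is harmless: for a cube Q' inside Q, either both polynomials
    are 0, or P_Q' f - P = P_Q' (f - P), where P is the possibly truncated polynomial of Q. The sign
    of alpha enters when |Q'|^(-alpha p) is bounded below by |Q|^(-alpha p) on subcubes. The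
    stopping argument assumes f integrable on Q only, so q-integrability is a conclusion. It bounds
    the q-term of Q by a supremum over families inside Q; before families are united over disjoint
    cubes, one family per cube has to be picked that already controls the term up to a constant. *)

Section one_dimension.
Context {R : realType}.
Local Notation leb := (@lebesgue_measure R).

(** Lagrange interpolation at the first d+1 nodes: each basis polynomial at x is a product of d
    quotients |x - t j| / |t i - t j|, each at most l / delta. The nodes form an infinite sequence
    because [lagrange_gen] takes an injective one. *)
Lemma horner_le_samples d (p : {poly R}) (l delta : R) (t : nat -> R) (x : R) :
  (size p <= d.+1)%N -> 0 < delta ->
  (forall i j, i != j -> delta <= `|t i - t j|) ->
  (forall i, (i <= d)%N -> `|x - t i| <= l) ->
  `|p.[x]| <= (l / delta) ^+ d * \sum_(i < d.+1) `|p.[t i]|.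
Proof.
move=> sp d0 sep xl.
have tinj : injective t.
  move=> i j tij; apply/eqP/negP => /negP /sep.
  by rewrite tij subrr normr0 leNgt d0.
have l0 : 0 <= l by exact: le_trans (normr_ge0 _) (xl 0%N isT).
rewrite {1}(lagrange_gen (ltn0Sn d) tinj sp) horner_sum.
apply: (le_trans (ler_norm_sum _ _ _)); rewrite mulr_sumr.
apply: ler_sum => i _; rewrite lagrangeE//= hornerM hornerC normrM mulrC.
apply: ler_wpM2r; first exact: normr_ge0.
rewrite hornerM hornerC !horner_prod normrM normfV !normr_prod -prodfV -big_split/=.
have cardE : #|[pred j : 'I_d.+1 | (j : nat) != i]| = d.
  have := cardC1 i; rewrite card_ord/= => E; rewrite -[RHS]E.
  by apply: eq_card => j.
rewrite -[d in X in _ <= X]cardE -prodr_const; apply: ler_prod => j ji.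
rewrite !hornerXsubC mulrC mulr_ge0 ?invr_ge0//=.
have tij : delta <= `|t i - t j| by apply: sep; rewrite eq_sym.
apply: ler_pM; rewrite ?invr_ge0//; first by apply: xl; rewrite -ltnS.
by rewrite lef_pV2// posrE (lt_le_trans d0).
Qed.

Lemma continuous_horner (p : {poly R}) : continuous (fun x => p.[x]).
Proof.
elim/poly_ind: p => [|p c IH].
  by rewrite (_ : horner _ = cst 0) => [x|]; [exact: cst_continuous|apply/funext => x; rewrite horner0].
rewrite (_ : horner _ = fun x => p.[x] * x + c); last first.
  by apply/funext => x; rewrite !hornerE.
move=> x; apply: cvgD; last exact: cvg_cst.
by apply: cvgM; [exact: IH|exact: cvg_id].
Qed.

Lemma measurable_horner (p : {poly R}) : measurable_fun setT (fun x => p.[x]).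
Proof. by apply: measurable_realfun.continuous_measurable_fun; exact: continuous_horner. Qed.

(** The point is a minimum of |p| on the interval, where |p| cannot exceed its mean. *)
Lemma poly_le_mean_itv (p : {poly R}) (a b : R) : a < b ->
  exists2 t, t \in `[a, b] &
    ((`|p.[t]| * (b - a))%:E <= \int[leb]_(x in `[a, b]) `|p.[x]|%:E)%E.
Proof.
move=> ab.
have cp : continuous (fun x => `|p.[x]|).
  move=> x; apply: continuous_comp; last exact: norm_continuous.
  exact: continuous_horner.
have [||t tab tmin] := @EVT_min R (fun x => `|p.[x]|) a b.
- exact: ltW.
- exact: continuous_subspaceT.
exists t => //.
have -> : ((`|p.[t]| * (b - a))%:E = \int[leb]_(x in `[a, b]) cst (`|p.[t]|%:E) x)%E.
  by rewrite integral_cst//= lebesgue_measure_itv/= lte_fin ab EFinM EFinB.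
apply: ge0_le_integral => //.
- by move=> y _ /=; rewrite lee_fin.
- apply/measurable_EFinP; apply: measurable_funTS.
  exact: continuous_measurable_fun.
Qed.

(* Sampling p at a point of each of d+1 separated subintervals where |p| is at
   most its mean reduces the bound to Lagrange interpolation. *)
Lemma poly_sup_le_integral d (p : {poly R}) (a l : R) (b1 b2 : bool) (x : R) :
  (size p <= d.+1)%N -> 0 < l -> a <= x <= a + l ->
  ((`|p.[x]| * l)%:E <= (d.+1%:R * (2 * d + 3)%:R ^+ d.+1)%:E *
    \int[leb]_(y in [set` Interval (BSide b1 a) (BSide b2 (a + l)%R)]) `|p.[y]|%:E)%E.
Proof.
move=> sp l0 xal.
set J := [set` Interval (BSide b1 a) (BSide b2 (a + l))]; set c : R := (2 * d + 3)%:R.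
have c0 : 0 < c by rewrite ltr0n addn3.
have mJ : measurable J by exact: measurable_itv.
set It := integral _ _ _.
have dlt : 0 < l / c by rewrite divr_gt0.
(* Cut [a, a + l] into 2d+3 equal pieces and keep those of odd index 2i+1, counted from 0. Two kept
   pieces are at least l / c apart, and both end pieces are skipped, so it does not matter which
   endpoints belong to the interval. *)
pose u i : R := a + l / c * (2 * i + 1)%:R.
have uu i : u i < u i + l / c by rewrite ltrDl.
have /choice [t tP] : forall i, exists t, t \in `[u i, u i + l / c] /\
    (((`|p.[t]| * (u i + l / c - u i))%:E <= \int[leb]_(x in `[u i, (u i + l / c)%R]) `|p.[x]|%:E)%E).
  by move=> i; have [t] := poly_le_mean_itv p (uu i); exists t.
have tI i : (i <= d)%N -> ((`|p.[t i]| * (l / c))%:E <= It)%E.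
  move=> id; have [_ ] := tP i; rewrite addrAC subrr add0r => /le_trans; apply.
  apply: ge0_subset_integral => //.
    apply/measurable_EFinP; apply: measurableT_comp => //.
    by apply: measurable_funTS; exact: measurable_horner.
  move=> y/=; rewrite /J/= !in_itv/= => /andP[y1 y2].
  have ay : a < y.
    apply: lt_le_trans y1; rewrite ltrDl mulr_gt0// ltr0n; lia.
  have ya : y < a + l.
    apply: le_lt_trans y2 _; rewrite -addrA ltrD2l -{2}(mulr1 (l / c)) -mulrDr.
    rewrite [X in _ < X](_ : _ = l / c * c); last by rewrite divfK// gt_eqF.
    rewrite ltr_pM2l// /c -(natrD _ _ 1) ltr_nat; lia.
  by apply/andP; split; [case: (b1)|case: (b2)]; rewrite /= ?ltW.
have It0 : (0 <= It)%E by apply: integral_ge0.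
have [->|Ifin] := eqVneq It +oo%E.
  by rewrite gt0_muley ?leey// lte_fin mulr_gt0// ?ltr0n// exprn_gt0.
have Ie : It = (fine It)%:E by rewrite fineK// ge0_fin_numE// ltey.
rewrite Ie -EFinM lee_fin.
have sep : forall i j, i != j -> l / c <= `|t i - t j|.
  suff H : forall i j, (i < j)%N -> l / c <= `|t i - t j|.
    move=> i j; rewrite neq_ltn => /orP[/H//|/H]; by rewrite distrC.
  move=> i j ij; have [+ _] := tP i; have [+ _] := tP j.
  rewrite !in_itv/= => /andP[t1 _] /andP[_ t2].
  rewrite distrC; apply: le_trans (ler_norm _).
  have : u i + l / c + l / c <= u j.
    rewrite /u -!addrA lerD2l -{2 3}(mulr1 (l / c)) -!mulrDr ler_pM2l// -[1]/(1%:R) -!natrD ler_nat; lia.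
  lra.
have xl : forall i, (i <= d)%N -> `|x - t i| <= l.
  move=> i id; have [+ _] := tP i; rewrite in_itv/= => /andP[t1 t2].
  have h1 : a <= u i by rewrite lerDl mulr_ge0 ?ltW.
  have h2 : u i + l / c <= a + l.
    rewrite /u -addrA lerD2l -{2}(mulr1 (l / c)) -mulrDr.
    rewrite [X in _ <= X](_ : _ = l / c * c); last by rewrite divfK// gt_eqF.
    rewrite ler_pM2l// /c -(natrD _ _ 1) ler_nat; lia.
  by rewrite ler_norml; apply/andP; split; lra.
have := horner_le_samples sp dlt sep xl.
have -> : l / (l / c) = c by rewrite invf_div mulrC divfK// gt_eqF.
move=> /(ler_wpM2r (ltW l0)) /le_trans; apply.
have -> : d.+1%:R * c ^+ d.+1 * fine It = c ^+ d * \sum_(i < d.+1) (c * fine It).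
  by rewrite sumr_const card_ord -mulr_natl exprS; ring.
rewrite -[_ * _ * l]mulrA; apply: ler_wpM2l; first by rewrite exprn_ge0 ?ltW.
rewrite mulr_suml; apply: ler_sum => i _.
have := tI i; rewrite Ie lee_fin => /(_ (ltn_ord i)).
by rewrite mulrA ler_pdivrMr// [_ * c]mulrC.
Qed.

End one_dimension.

(** * Boxes and Tonelli's theorem *)

Section cube_basics.
Context {R : realType}.

Lemma measurable_coord n (i : 'I_n) :
  measurable_fun setT (fun x : euclid R n => coord x i).
Proof. exact: measurable_tnth. Qed.

Lemma measurable_box n (A : 'I_n -> set (measurableTypeR R)) :
  (forall i, measurable (A i)) ->
  measurable [set x : euclid R n | forall i, A i (coord x i)].
Proof.
move=> mA; rewrite (_ : mkset _ = \bigcap_(i in setT)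
    ((fun x => tnth x i) @^-1` A i)); last first.
  by apply/seteqP; split => x Ax i//=; exact: Ax.
apply: fin_bigcap_measurable => // i _.
by rewrite -[X in measurable X]setTI; exact: measurable_tnth.
Qed.

Lemma measurable_set_of_cube n (Q : cube R n) : measurable (set_of_cube Q).
Proof. by apply: (measurable_box (A := fun i => [set` edge Q i])) => i; exact: measurable_itv. Qed.

Lemma lebesgue_edge n (Q : cube R n) i :
  lebesgue_measure [set` edge Q i] = (side Q)%:E.
Proof.
rewrite lebesgue_measure_itv/= lte_fin ltrDl side_gt0.
by rewrite -EFinB addrAC subrr add0r.
Qed.

Lemma lebesgue_n_cube n (Q : cube R n) :
  lebesgue_n n (set_of_cube Q) = (side Q ^+ n)%:E.
Proof.
rewrite (@lebesgue_n_box _ _ (fun i => [set` edge Q i])); last first.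
  by move=> i; exact: measurable_itv.
under eq_bigr do rewrite lebesgue_edge.
by rewrite prodEFin prodr_const card_ord.
Qed.

Lemma cube_volE n (Q : cube R n) : cube_vol Q = side Q ^+ n.
Proof. by rewrite /cube_vol lebesgue_n_cube. Qed.

Lemma cube_vol_gt0 n (Q : cube R n) : 0 < cube_vol Q.
Proof. by rewrite cube_volE exprn_gt0// side_gt0. Qed.

Lemma lebesgue_n_cube_vol n (Q : cube R n) :
  lebesgue_n n (set_of_cube Q) = (cube_vol Q)%:E.
Proof. by rewrite cube_volE lebesgue_n_cube. Qed.

Definition cube_tail n (Q : cube R n.+1) : cube R n :=
  Cube (fun i => corner Q (lift ord0 i)) (side_gt0 Q)
       (fun i => lclosed Q (lift ord0 i)) (fun i => rclosed Q (lift ord0 i)).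

Lemma coord_tuple_cons0 n (t : measurableTypeR R) (y : euclid R n) :
  coord (tuple_cons (t, y)) ord0 = t.
Proof. by []. Qed.

Lemma coord_tuple_consS n (t : measurableTypeR R) (y : euclid R n) i :
  coord (tuple_cons (t, y)) (lift ord0 i) = coord y i.
Proof. by rewrite /coord tnthS. Qed.

Lemma set_of_cube_cons n (Q : cube R n.+1) t y :
  set_of_cube Q (tuple_cons (t, y)) <->
  t \in edge Q ord0 /\ set_of_cube (cube_tail Q) y.
Proof.
split=> [H|[H1 H2] i].
  split; first exact: (H ord0).
  by move=> i; have := H (lift ord0 i); rewrite coord_tuple_consS.
by have [j ->|->//] := unliftP ord0 i; rewrite coord_tuple_consS; exact: H2.
Qed.

Lemma ge0_integral_cube_cons n (Q : cube R n.+1) (g : euclid R n.+1 -> R) :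
  measurable_fun setT g -> (forall x, 0 <= g x) ->
  (\int[lebesgue_n n.+1]_(x in set_of_cube Q) (g x)%:E =
   \int[lebesgue_measure]_(t in [set` edge Q ord0])
     \int[lebesgue_n n]_(y in set_of_cube (cube_tail Q)) (g (tuple_cons (t, y)))%:E)%E.
Proof.
move=> mg g0.
rewrite /= (_ : integral _ _ _ =
   integral (pushforward (lebesgue_measure \x lebesgue_n n)%E (@tuple_cons R n))
     (set_of_cube Q) (EFin \o g))//.
have mc := @measurable_tuple_cons R n.
rewrite ge0_integral_pushforward//; last 3 first.
- exact: measurable_set_of_cube.
- by apply/measurable_EFinP; exact: measurable_funTS.
- by move=> x _; rewrite lee_fin.
have mQ : measurable (tuple_cons @^-1` set_of_cube Q).
  by rewrite -[X in measurable X]setTI; apply: mc => //; exact: measurable_set_of_cube.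
rewrite integral_mkcond fubini_tonelli1; last 2 first.
- have mgc : measurable_fun (tuple_cons @^-1` set_of_cube Q) (EFin \o g \o (@tuple_cons R n)).
    apply: measurable_funTS; apply/measurable_EFinP.
    exact: measurableT_comp.
  exact: (measurable_restrictT _ mQ).1 mgc.
- by move=> z; rewrite patchE; case: ifP => // _; rewrite lee_fin.
rewrite [RHS]integral_mkcond; apply: eq_integral => t _.
rewrite /fubini_F patchE; case: ifPn => [/set_mem tJ|/negP tJ].
  rewrite [RHS]integral_mkcond; apply: eq_integral => y _.
  rewrite !patchE; congr (if _ then _ else _).
  apply/idP/idP => /set_mem H; apply/mem_set.
    by have /set_of_cube_cons[] := H.
  by apply/set_of_cube_cons.
apply: integral0_eq => y _; rewrite patchE; case: ifPn => // /set_mem H.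
by exfalso; apply: tJ; apply/mem_set; have /set_of_cube_cons[] := H.
Qed.

(** This allows slice estimates to be integrated over the first coordinate in
    [monomial_sum_le_integral]. *)
Lemma measurable_integral_slice n (Q : cube R n) (g : euclid R n.+1 -> R) :
  measurable_fun setT g -> (forall x, 0 <= g x) ->
  measurable_fun setT (fun t : measurableTypeR R =>
    (\int[lebesgue_n n]_(y in set_of_cube Q) (g (tuple_cons (t, y)))%:E)%E).
Proof.
move=> mg g0; have mc := @measurable_tuple_cons R n.
have mTQ : measurable ([set: measurableTypeR R] `*` set_of_cube Q).
  by apply: measurableX => //; exact: measurable_set_of_cube.
pose f := (EFin \o g \o (@tuple_cons R n)) \_ ([set: measurableTypeR R] `*` set_of_cube Q).
have mf : measurable_fun setT f.
  have mgc : measurable_fun ([set: measurableTypeR R] `*` set_of_cube Q)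
      (EFin \o g \o (@tuple_cons R n)).
    by apply: measurable_funTS; apply/measurable_EFinP; exact: measurableT_comp.
  exact: (measurable_restrictT _ mTQ).1 mgc.
have f0 z : (0 <= f z)%E.
  by rewrite /f patchE; case: ifP => // _; rewrite lee_fin.
have := @measurable_fun_fubini_tonelli_F _ _ _ _ R (lebesgue_n n) f mf f0.
apply: eq_measurable_fun => t _; rewrite /fubini_F [RHS]integral_mkcond.
apply: eq_integral => y _; rewrite /f !patchE.
congr (if _ then _ else _).
by apply/idP/idP => /set_mem H; apply/mem_set; [case: H|split].
Qed.

(** * Sup bounds for polynomials in several variables *)

Section monomial_sums.
Variables (I : Type) (r : seq I).
Implicit Types (c : I -> R).

(** Polynomials over a fixed index list, repeated exponents allowed. Freezing the first coordinate
    moves its powers into the coefficients and keeps the list, so the form is stable under slicing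
    and suits induction on n. *)
Definition monomial_sum n c (e : I -> 'I_n -> nat) (x : euclid R n) : R :=
  \sum_(i <- r) c i * \prod_(j < n) coord x j ^+ e i j.

Lemma measurable_monomial_sum n c (e : I -> 'I_n -> nat) :
  measurable_fun setT (monomial_sum c e).
Proof.
apply: measurable_sum => i; apply: measurable_funM => //.
apply: measurable_prod => j _; apply: measurable_funX.
exact: measurable_coord.
Qed.

Lemma monomial_sum_cons n c (e : I -> 'I_n.+1 -> nat) t y :
  monomial_sum c e (tuple_cons (t, y)) =
  monomial_sum (fun i => c i * t ^+ e i ord0) (fun i j => e i (lift ord0 j)) y.
Proof.
apply: eq_bigr => i _; rewrite big_ord_recl coord_tuple_cons0 mulrA.
by congr *%R; apply: eq_bigr => j _; rewrite coord_tuple_consS.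
Qed.

Lemma monomial_sum_horner n c d (e : I -> 'I_n.+1 -> nat) y :
  (forall i j, (e i j <= d)%N) ->
  exists2 p : {poly R}, (size p <= d.+1)%N &
    forall t, monomial_sum c e (tuple_cons (t, y)) = p.[t].
Proof.
move=> ed; exists (\sum_(i <- r) (c i * \prod_(j < n) coord y j ^+ e i (lift ord0 j))
    *: 'X^(e i ord0)).
  elim/big_ind: _ => [|p q sp sq|i _]; first by rewrite size_poly0.
    by rewrite (leq_trans (size_polyD _ _))// geq_max sp.
  by rewrite (leq_trans (size_scale_leq _ _))// size_polyXn ltnS.
move=> t; rewrite monomial_sum_cons horner_sum; apply: eq_bigr => i _.
by rewrite !hornerE; ring.
Qed.

(** The constant of [poly_sup_le_integral]. *)
Definition poly_const (d : nat) : R := d.+1%:R * (2 * d + 3)%:R ^+ d.+1.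

Lemma poly_const_gt0 d : 0 < poly_const d.
Proof. by rewrite mulr_gt0 ?exprn_gt0// ltr0n// addn3. Qed.

(** Induction on the dimension: the one-variable bound is applied along the line through x in the
    first direction, and the induction hypothesis on the slice at each point of that line. The
    degree is bounded in each variable separately, so every direction costs the same factor. *)
Lemma monomial_sum_le_integral n d c (e : I -> 'I_n -> nat) (Q : cube R n) x :
  (forall i j, (e i j <= d)%N) -> set_of_cube Q x ->
  ((`|monomial_sum c e x| * side Q ^+ n)%:E <= (poly_const d ^+ n)%:E *
    \int[lebesgue_n n]_(y in set_of_cube Q) `|monomial_sum c e y|%:E)%E.
Proof.
elim: n c e Q x => [|n IH] c e Q x ed Qx.
  rewrite !expr0 mulr1 mul1e /= integral_dirac//; last 2 first.
  - exact: measurable_set_of_cube.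
  - apply/measurable_EFinP/measurable_funTS; apply: measurableT_comp => //.
    exact: measurable_monomial_sum.
  rewrite diracE mem_set ?mul1e; last by case.
  by rewrite (tuple0 x).
have mg : measurable_fun setT (fun x => `|monomial_sum c e x|).
  by apply: measurableT_comp => //; exact: measurable_monomial_sum.
rewrite ge0_integral_cube_cons//.
rewrite -(tuple_unconsK x) in Qx *; move: (tuple_uncons x) Qx => [t y] Qx.
have [tJ yQ] := (set_of_cube_cons Q t y).1 Qx.
have [p sp pE] := monomial_sum_horner c y ed.
have side0 := side_gt0 Q.
have tJ' : corner Q ord0 <= t <= corner Q ord0 + side Q.
  move: tJ; rewrite /edge in_itv/= => /andP[t1 t2]; apply/andP; split.
    by move: t1; case: lclosed => //=; exact: ltW.
  by move: t2; case: rclosed => //=; exact: ltW.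
have := poly_sup_le_integral (lclosed Q ord0) (~~ rclosed Q ord0) sp side0 tJ'.
rewrite -/(edge Q ord0) -/(poly_const d) pE => H.
have Cd0 := poly_const_gt0 d.
apply: (@le_trans _ _ ((side Q ^+ n)%:E * ((poly_const d)%:E *
  \int[lebesgue_measure]_(y in [set` edge Q ord0]) `|p.[y]|%:E)))%E.
  have -> : `|p.[t]| * side Q ^+ n.+1 = side Q ^+ n * (`|p.[t]| * side Q).
    by rewrite exprS; ring.
  by rewrite EFinM; apply: lee_wpmul2l => //; rewrite lee_fin exprn_ge0// ltW.
rewrite muleCA (exprS (poly_const d)) [(_ * poly_const d ^+ n)%:E]EFinM -(muleA (poly_const d)%:E).
apply: lee_wpmul2l.
  by rewrite lee_fin ltW.
have mp : measurable_fun [set` edge Q ord0] (fun t => `|p.[t]|%:E).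
  apply/measurable_EFinP; apply: measurableT_comp => //.
  by apply: measurable_funTS; exact: measurable_horner.
have mJ : measurable [set` edge Q ord0] by exact: measurable_itv.
have ms := measurable_integral_slice (cube_tail Q) mg (fun x => normr_ge0 _).
have e0 (k : R) : 0 <= k -> (0 <= (k ^+ n)%:E)%E by move=> k0; rewrite lee_fin exprn_ge0.
rewrite -!ge0_integralZl//; try exact: measurable_funTS; try (by apply: e0; exact: ltW);
  try (by move=> z _; apply: integral_ge0).
apply: ge0_le_integral => //.
- by move=> z _; apply: mule_ge0 => //; apply: e0; exact: ltW.
- exact: measurable_funeM.
- by apply: measurable_funeM; exact: measurable_funTS.
move=> u _; rewrite -pE monomial_sum_cons -EFinM mulrC.
under eq_integral do rewrite monomial_sum_cons.
by apply: (IH _ _ (cube_tail Q)).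
Qed.

End monomial_sums.
End cube_basics.

(** * The projections onto polynomials *)

Section cube_polynomials.
Context {R : realType} {n : nat}.
Local Notation mu := (@lebesgue_n R n).
Implicit Types (Q : cube R n) (f : euclid R n -> R) (P G : mpoly.mpoly n R).

Lemma poly_evalE P x : poly_eval P x =
  \sum_(m <- mpoly.msupp P) mpoly.mcoeff m P * monomial m x.
Proof. by []. Qed.

(** On the support of P the minimum is the exponent itself; it is there because the sup bound asks
    for exponents at most d at every index, in the support or not. *)
Lemma poly_eval_monomial_sum d P : (mpoly.msize P <= d.+1)%N ->
  poly_eval P = monomial_sum (mpoly.msupp P)
    (fun m => mpoly.mcoeff m P) (fun m j => minn ((m : mpoly.multinom n) j) d).
Proof.
move=> Pd; apply/funext => x; rewrite poly_evalE; apply: eq_big_seq => m mP.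
congr *%R; apply: eq_bigr => j _; congr (_ ^+ _); apply/esym/minn_idPl.
have := mpoly.msize_mdeg_lt mP => /leq_trans/(_ Pd); rewrite ltnS => /(leq_trans _); apply.
by rewrite mpoly.mdegE (bigD1 j)//= leq_addr.
Qed.

Lemma measurable_poly_eval P : measurable_fun setT (poly_eval P).
Proof.
by rewrite (poly_eval_monomial_sum (leqnSn _)); exact: measurable_monomial_sum.
Qed.

Lemma measurable_monomial m : measurable_fun setT (@monomial R n m).
Proof.
apply: measurable_prod => j _; apply: measurable_funX.
exact: measurable_coord.
Qed.

Lemma cube_coord_le Q x j : set_of_cube Q x ->
  `|coord x j| <= `|corner Q j| + side Q.
Proof.
move=> /(_ j); rewrite /edge in_itv/= => /andP[h1 h2].
have k1 : corner Q j <= coord x j by move: h1; case: lclosed => //=; exact: ltW.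
have k2 : coord x j <= corner Q j + side Q by move: h2; case: rclosed => //=; exact: ltW.
have := ler_norm (corner Q j); have := ler_norm (- corner Q j); rewrite normrN.
have := side_gt0 Q; rewrite ler_norml; move: `|corner Q j| => c *.
by apply/andP; split; lra.
Qed.

Lemma monomial_bounded Q m : exists B, forall x, set_of_cube Q x -> `|@monomial R n m x| <= B.
Proof.
exists (\prod_(j < n) (`|corner Q j| + side Q) ^+ m j) => x Qx.
rewrite /monomial /mpoly.mmap1 normr_prod.
apply: ler_prod => j _; rewrite normr_ge0 normrX/= lerXn2r// ?nnegrE//.
  by rewrite addr_ge0// ltW// side_gt0.
exact: cube_coord_le.
Qed.

Lemma poly_eval_bounded Q P : exists B, forall x, set_of_cube Q x -> `|poly_eval P x| <= B.
Proof.
have /choice[B BP] := monomial_bounded Q.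
exists (\sum_(m <- mpoly.msupp P) `|mpoly.mcoeff m P| * B m) => x Qx.
rewrite poly_evalE; apply: (le_trans (ler_norm_sum _ _ _)); apply: ler_sum => m _.
by rewrite normrM ler_wpM2l// BP.
Qed.

Definition cube_integrable Q f := mu.-integrable (set_of_cube Q) (EFin \o f).

Lemma cube_integrableM Q f (g : euclid R n -> R) : cube_integrable Q f -> measurable_fun setT g ->
  (exists B, forall x, set_of_cube Q x -> `|g x| <= B) ->
  cube_integrable Q (fun x => f x * g x).
Proof.
move=> fi mg [B BP].
have mQ := measurable_set_of_cube Q.
have mf : measurable_fun (set_of_cube Q) f.
  by apply/measurable_EFinP; exact: measurable_int fi.
apply: (@le_integrable _ _ _ _ _ mQ _ (fun x => B%:E * (EFin \o f) x)%E).
- apply/measurable_EFinP; apply: measurable_funM => //.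
  exact: measurable_funTS.
- move=> x Qx; rewrite /= lee_fin !normrM mulrC ler_wpM2r//.
  exact: le_trans (BP x Qx) (ler_norm _).
- exact: integrableZl.
Qed.

Lemma cube_integrable_bounded Q f : measurable_fun setT f ->
  (exists B, forall x, set_of_cube Q x -> `|f x| <= B) -> cube_integrable Q f.
Proof.
move=> mf bf.
have h : cube_integrable Q (cst 1).
  apply/integrableP; split; first by apply/measurable_EFinP; exact: measurable_cst.
  rewrite (eq_integral (cst 1%E)) => [|x _]; last by rewrite /= normr1.
  rewrite integral_cst; last exact: measurable_set_of_cube.
  by rewrite mul1e [X in (X < _)%E](lebesgue_n_cube Q) ltry.
have := cube_integrableM h mf bf.
by under [X in cube_integrable Q X]eq_fun do rewrite mul1r.
Qed.

Lemma cube_integrable_poly Q P : cube_integrable Q (poly_eval P).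
Proof.
apply: cube_integrable_bounded; first exact: measurable_poly_eval.
exact: poly_eval_bounded.
Qed.

Lemma cube_integrableB Q f g : cube_integrable Q f -> cube_integrable Q g ->
  cube_integrable Q (fun x => f x - g x).
Proof. by move=> fi gi; apply: (integrableB (measurable_set_of_cube Q) fi gi). Qed.

Lemma cube_integrableMpoly Q f P : cube_integrable Q f ->
  cube_integrable Q (fun x => f x * poly_eval P x).
Proof.
move=> fi; apply: cube_integrableM => //; first exact: measurable_poly_eval.
exact: poly_eval_bounded.
Qed.

Lemma cube_integrableMmonomial Q f m : cube_integrable Q f ->
  cube_integrable Q (fun x => f x * monomial m x).
Proof.
move=> fi; apply: cube_integrableM => //; first exact: measurable_monomial.
exact: monomial_bounded.
Qed.

Lemma Rintegral_cube_sum Q (I : Type) (r : seq I) (h : I -> euclid R n -> R) :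
  (forall i, cube_integrable Q (h i)) ->
  \int[mu]_(x in set_of_cube Q) (\sum_(i <- r) h i x) =
  \sum_(i <- r) \int[mu]_(x in set_of_cube Q) h i x.
Proof.
move=> hi; have mQ := measurable_set_of_cube Q.
have : cube_integrable Q (fun x => \sum_(i <- r) h i x) /\
    \int[mu]_(x in set_of_cube Q) (\sum_(i <- r) h i x) =
    \sum_(i <- r) \int[mu]_(x in set_of_cube Q) h i x; last by case.
elim: r => [|i r [IH1 IH2]].
  rewrite big_nil; under [X in cube_integrable Q X]eq_fun do rewrite big_nil.
  under eq_Rintegral do rewrite big_nil.
  by split; [exact: integrable0|rewrite Rintegral_cst// mul0r].
rewrite big_cons -IH2 -RintegralD//; last exact: hi.
under [X in cube_integrable Q X]eq_fun do rewrite big_cons.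
under eq_Rintegral do rewrite big_cons.
by split => //; apply: (integrableD mQ (hi i) IH1).
Qed.

Lemma Rintegral_eq0P Q f : cube_integrable Q f ->
  \int[mu]_(x in set_of_cube Q) f x = 0 <->
  (\int[mu]_(x in set_of_cube Q) (f x)%:E = 0)%E.
Proof.
move=> fi; have h := integrable_fin_num (measurable_set_of_cube Q) fi.
rewrite /Rintegral; split => [|->//] h0.
by rewrite -[LHS]fineK// h0.
Qed.

Lemma is_cube_poly_orth s Q f P G : cube_integrable Q f -> is_cube_poly s Q f P ->
  (mpoly.msize G <= s.+1)%N ->
  \int[mu]_(x in set_of_cube Q) ((f x - poly_eval P x) * poly_eval G x) = 0.
Proof.
move=> fi [sP orth] sG.
have fPi := cube_integrableB fi (cube_integrable_poly Q P).
have hi m : cube_integrable Q (fun x => mpoly.mcoeff m G *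
    ((f x - poly_eval P x) * monomial m x)).
  exact: (integrableZl (measurable_set_of_cube Q) _ (cube_integrableMmonomial m fPi)).
transitivity (\int[mu]_(x in set_of_cube Q) (\sum_(m <- mpoly.msupp G)
    mpoly.mcoeff m G * ((f x - poly_eval P x) * monomial m x))).
  apply: eq_Rintegral => x _; rewrite [poly_eval G x]poly_evalE mulr_sumr.
  by apply: eq_bigr => m _; rewrite mulrCA.
rewrite Rintegral_cube_sum// big1_seq// => m /andP[_ mG].
rewrite RintegralZl//; last 2 first.
- exact: measurable_set_of_cube.
- exact: cube_integrableMmonomial.
rewrite (Rintegral_eq0P (cube_integrableMmonomial m fPi)).2 ?mulr0//.
by apply: orth; rewrite -ltnS (leq_trans (mpoly.msize_mdeg_lt mG)).
Qed.

Definition proj_const s : R := poly_const (2 * s) ^+ n.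

(** The L^1 bound applied to P * P, of degree at most 2s, which explains the degree in [proj_const].
    It compares the supremum with the L^2 norm without an orthonormal basis. *)
Lemma poly_sqr_le_integral s Q P x : (mpoly.msize P <= s.+1)%N -> set_of_cube Q x ->
  poly_eval P x ^+ 2 * cube_vol Q <=
  proj_const s * \int[mu]_(y in set_of_cube Q) (poly_eval P y * poly_eval P y).
Proof.
move=> sP Qx.
have PPE y : poly_eval (P * P) y = poly_eval P y * poly_eval P y.
  by rewrite /poly_eval mpoly.mevalM.
have sPP : (mpoly.msize (P * P) <= (2 * s).+1)%N.
  have [->|P0] := eqVneq P 0; first by rewrite mul0r mpoly.msize0.
  rewrite mpoly.msizeM//; move: (mpoly.msize P) sP => k sP; lia.
have e2 m j : (minn ((m : mpoly.multinom n) j) (2 * s) <= 2 * s)%N by exact: geq_minr.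
have := monomial_sum_le_integral (mpoly.msupp (P * P))
  (fun m => mpoly.mcoeff m (P * P)) e2 Qx.
rewrite -(poly_eval_monomial_sum sPP) -lee_fin cube_volE PPE ger0_norm; last first.
  by rewrite -expr2 sqr_ge0.
rewrite expr2 => /le_trans; apply; rewrite EFinM; apply: lee_wpmul2l.
  by rewrite lee_fin exprn_ge0// ltW// poly_const_gt0.
rewrite /Rintegral fineK; last first.
  apply: integrable_fin_num; first exact: measurable_set_of_cube.
  exact: (cube_integrableMpoly P (cube_integrable_poly Q P)).
rewrite le_eqVlt; apply/orP; left; apply/eqP; apply: eq_integral => y _.
by rewrite PPE ger0_norm// -expr2 sqr_ge0.
Qed.

(* With M the supremum of |P| on Q, orthogonality turns the L^2 bound into
   M^2 |Q| <= C \int P^2 = C \int f P <= C M \int |f|. *)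
Lemma is_cube_poly_bound s Q f P x : cube_integrable Q f -> is_cube_poly s Q f P ->
  set_of_cube Q x ->
  `|poly_eval P x| * cube_vol Q <=
  proj_const s * \int[mu]_(y in set_of_cube Q) `|f y|.
Proof.
move=> fi cP Qx; have mQ := measurable_set_of_cube Q.
have [sP _] := cP.
set I := \int[mu]_(y in set_of_cube Q) `|f y|.
have I0 : 0 <= I by apply: Rintegral_ge0.
pose S := [set `|poly_eval P y| | y in set_of_cube Q].
have S0 : S !=set0 by exists `|poly_eval P x|, x.
have [B BP] := poly_eval_bounded Q P.
have ubS : has_sup S by split => //; exists B => _ [y Qy <-]; exact: BP.
pose M := sup S.
have MP y : set_of_cube Q y -> `|poly_eval P y| <= M.
  by move=> Qy; apply: sup_upper_bound => //; exists y.
have M0 : 0 <= M by exact: le_trans (MP x Qx).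
have V0 := cube_vol_gt0 Q.
have C0 : 0 < proj_const s by rewrite exprn_gt0// poly_const_gt0.
have fPi := cube_integrableMpoly P fi.
have PPi := cube_integrableMpoly P (cube_integrable_poly Q P).
have PPf : \int[mu]_(y in set_of_cube Q) (poly_eval P y * poly_eval P y) <= M * I.
  have <- : \int[mu]_(y in set_of_cube Q) (f y * poly_eval P y) =
      \int[mu]_(y in set_of_cube Q) (poly_eval P y * poly_eval P y).
    apply/eqP; rewrite -subr_eq0 -RintegralB//; apply/eqP.
    rewrite -[RHS](is_cube_poly_orth fi cP sP); apply: eq_Rintegral => y _.
    by rewrite mulrBl.
  have fni : cube_integrable Q (fun y => `|f y|) by exact: integrable_norm.
  rewrite /I -RintegralZl//; apply: le_Rintegral => //.
    exact: (integrableZl mQ M fni).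
  move=> y Qy; rewrite (le_trans (ler_norm _))// normrM mulrC ler_wpM2r//.
  exact: MP.
have key y : set_of_cube Q y -> `|poly_eval P y| ^+ 2 * cube_vol Q <= proj_const s * (M * I).
  move=> Qy; rewrite real_normK ?num_real//.
  apply: (le_trans (poly_sqr_le_integral sP Qy)).
  by rewrite ler_wpM2l// ltW.
have Msqr : M ^+ 2 <= proj_const s * (M * I) / cube_vol Q.
  rewrite -ler_sqrt; last by rewrite divr_ge0 ?mulr_ge0// ltW.
  rewrite sqrtr_sqr ger0_norm//; apply: ge_sup => // _ [y Qy <-].
  rewrite -[leLHS]ger0_norm// -sqrtr_sqr ler_wsqrtr//.
  by rewrite ler_pdivlMr//; exact: key.
apply: (@le_trans _ _ (M * cube_vol Q)); first by rewrite ler_wpM2r ?(ltW V0)// MP.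
have [M00|Mn0] := eqVneq M 0; first by rewrite M00 mul0r mulr_ge0// ltW.
have Mp : 0 < M by rewrite lt_neqAle eq_sym Mn0.
rewrite -ler_pdivlMr// -(ler_pM2l Mp) -expr2 (le_trans Msqr)//.
by rewrite le_eqVlt; apply/orP; left; apply/eqP; ring.
Qed.

(** The exponents of degree at most s form a finite type, so the coefficients can be read as a
    vector and the orthogonality conditions as a matrix equation. *)
Definition poly_of s (c : mpoly.bmultinom n s.+1 -> R) : mpoly.mpoly n R :=
  \sum_(m : mpoly.bmultinom n s.+1) c m *: mpoly.mpolyX R m.

Lemma poly_of_eval s c x : poly_eval (@poly_of s c) x =
  \sum_(m : mpoly.bmultinom n s.+1) c m * monomial m x.
Proof.
rewrite /poly_eval /poly_of raddf_sum/=; apply: eq_bigr => m _.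
by rewrite mpoly.mevalZ mpoly.mevalX.
Qed.

Lemma poly_of_size s c : (mpoly.msize (@poly_of s c) <= s.+1)%N.
Proof.
apply: (leq_trans (mpoly.msize_sum _ _ _)); apply/bigmax_leqP => m _.
by rewrite (leq_trans (mpoly.msizeZ_le _ _))// mpoly.msizeX mpoly.bmdeg.
Qed.

Lemma Rintegral_mul_poly_of s Q f c : cube_integrable Q f ->
  \int[mu]_(x in set_of_cube Q) (f x * poly_eval (@poly_of s c) x) =
  \sum_(m : mpoly.bmultinom n s.+1)
    c m * \int[mu]_(x in set_of_cube Q) (f x * monomial m x).
Proof.
move=> fi; have mQ := measurable_set_of_cube Q.
have fmi m := cube_integrableMmonomial m fi.
transitivity (\int[mu]_(x in set_of_cube Q) (\sum_(m : mpoly.bmultinom n s.+1)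
    c m * (f x * monomial m x))).
  apply: eq_Rintegral => x _; rewrite poly_of_eval mulr_sumr.
  by apply: eq_bigr => m _; rewrite mulrCA.
rewrite Rintegral_cube_sum => [|m]; last exact: (integrableZl mQ _ (fmi m)).
apply: eq_bigr => m _; rewrite RintegralZl//; exact: fmi.
Qed.

(* The normal equations are solvable because a vector in the kernel of the Gram
   matrix is a polynomial with vanishing L^2 norm, which vanishes on the cube. *)
Lemma is_cube_poly_exists s Q f : cube_integrable Q f -> exists P, is_cube_poly s Q f P.
Proof.
move=> fi; have mQ := measurable_set_of_cube Q.
pose T := mpoly.bmultinom n s.+1.
pose mon (i : 'I_#|{: T}|) : euclid R n -> R := monomial (enum_val i : T).
have moni i : cube_integrable Q (mon i).
  apply: cube_integrable_bounded; first exact: measurable_monomial.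
  exact: monomial_bounded.
pose G := \matrix_(i, j) \int[mu]_(x in set_of_cube Q) (mon i x * mon j x).
pose b := \row_j \int[mu]_(x in set_of_cube Q) (f x * mon j x).
have sumE (F : T -> R) : \sum_(m : T) F m = \sum_(i < #|{: T}|) F (enum_val i).
  by rewrite (reindex_omap (@enum_val _ _) (fun m => Some (enum_rank m)))//= => [|m _];
    [apply: eq_bigl => i; rewrite enum_valK eqxx|rewrite enum_rankK].
(* A row lies in the row space of G as soon as it kills the cokernel of G. Each column of the
   cokernel is a vector in the kernel of the Gram matrix, that is, the coefficients of a polynomial
   V orthogonal to all monomials of degree at most s. *)
have /submxP[c cb] : (b <= G)%MS.
  rewrite submxE; move: (mulmx_coker G); move: (cokermx G) => K GK.
  apply/eqP/matrixP => i k; rewrite [RHS]mxE.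
  pose v (m : T) := K (enum_rank m) k.
  pose V := poly_of v.
  have vE j : v (enum_val j) = K j k by rewrite /v enum_valK.
  have Gv j : \int[mu]_(x in set_of_cube Q) (mon j x * poly_eval V x) = 0.
    rewrite Rintegral_mul_poly_of// sumE.
    move/matrixP : GK => /(_ j k); rewrite !mxE => e.
    by rewrite -[RHS]e; apply: eq_bigr => l _; rewrite vE mxE mulrC.
  have VV : \int[mu]_(x in set_of_cube Q) (poly_eval V x * poly_eval V x) = 0.
    rewrite Rintegral_mul_poly_of; last exact: cube_integrable_poly.
    rewrite sumE big1// => l _; under eq_Rintegral do rewrite mulrC.
    by rewrite (Gv l) mulr0.
  have V0 x : set_of_cube Q x -> poly_eval V x = 0.
    move=> Qx; have := poly_sqr_le_integral (poly_of_size v) Qx.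
    rewrite VV mulr0 pmulr_lle0; last exact: cube_vol_gt0.
    by move=> h; apply/eqP; rewrite -sqrf_eq0 eq_le h sqr_ge0.
  rewrite mxE -[RHS](_ : \int[mu]_(x in set_of_cube Q) (f x * poly_eval V x) = 0); last first.
    rewrite (@eq_Rintegral _ _ _ _ _ (cst 0)) => [|x /set_mem Qx].
      by rewrite Rintegral_cst// mul0r.
    by rewrite V0// mulr0.
  rewrite Rintegral_mul_poly_of// sumE; apply: eq_bigr => l _.
  by rewrite vE mxE mulrC.
pose P := poly_of (fun m : T => c 0 (enum_rank m)).
exists P; split; first exact: poly_of_size.
move=> m ms; have ms' : (mpoly.mdeg m < s.+1)%N by [].
pose m' : T := mpoly.BMultinom ms'.
have fPi := cube_integrableB fi (cube_integrable_poly Q P).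
apply/(Rintegral_eq0P (cube_integrableMmonomial m fPi)).
under eq_Rintegral do rewrite mulrBl.
rewrite RintegralB//; last 2 first.
- exact: cube_integrableMmonomial.
- exact: (cube_integrableMmonomial m (cube_integrable_poly Q P)).
apply/eqP; rewrite subr_eq0; apply/eqP.
move/matrixP : cb => /(_ 0 (enum_rank m')); rewrite !mxE /mon enum_rankK => ->.
have mi : cube_integrable Q (monomial m).
  by have := moni (enum_rank m'); rewrite /mon enum_rankK.
under [RHS]eq_Rintegral do rewrite mulrC.
rewrite Rintegral_mul_poly_of// sumE; apply: eq_bigr => l _.
rewrite enum_valK mxE /mon enum_rankK; congr *%R.
by apply: eq_Rintegral => x _; rewrite mulrC.
Qed.

Lemma cube_polyP s Q f : cube_integrable Q f -> is_cube_poly s Q f (cube_poly s Q f).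
Proof.
move=> fi; exact: (xgetPex (P := is_cube_poly s Q f) 0 (is_cube_poly_exists s fi)).
Qed.

Lemma cube_poly_loc_size s c0 Q f : cube_integrable Q f ->
  (mpoly.msize (cube_poly_loc s c0 Q f) <= s.+1)%N.
Proof.
rewrite /cube_poly_loc; case: ifP => _; last by rewrite mpoly.msize0.
by move=> /(cube_polyP s)[].
Qed.

Lemma cube_integrableS Q Q' f : set_of_cube Q' `<=` set_of_cube Q ->
  cube_integrable Q f -> cube_integrable Q' f.
Proof.
move=> QQ; apply: integrableS => //; exact: measurable_set_of_cube.
Qed.

(** If Q' has side below c0, then P_Q' f - P is the projection of f - P on Q', because P has degree
    at most s, and the sup bound for projections applies. This holds whether or not P is
    truncated. *)
Lemma cube_poly_loc_diff s c0 Q Q' f x : cube_integrable Q f ->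
  set_of_cube Q' `<=` set_of_cube Q -> side Q' <= side Q -> set_of_cube Q' x ->
  `|poly_eval (cube_poly_loc s c0 Q' f) x - poly_eval (cube_poly_loc s c0 Q f) x|
    * cube_vol Q' <=
  proj_const s * \int[mu]_(y in set_of_cube Q')
    `|f y - poly_eval (cube_poly_loc s c0 Q f) y|.
Proof.
move=> fi QQ sQ Qx; set P := cube_poly_loc s c0 Q f.
have fi' := cube_integrableS QQ fi.
have C0 : 0 <= proj_const s by rewrite exprn_ge0// ltW// poly_const_gt0.
have [Qc|cQ] := ltP (side Q') c0; last first.
  (* Q' reaches the threshold c0, hence so does the larger Q, and both polynomials are 0. *)
  rewrite /P /cube_poly_loc ltNge cQ/= ltNge (le_trans cQ sQ)/= subrr normr0 mul0r.
  by rewrite mulr_ge0// Rintegral_ge0.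
have -> : cube_poly_loc s c0 Q' f = cube_poly s Q' f by rewrite /cube_poly_loc Qc.
have sP : (mpoly.msize P <= s.+1)%N by exact: cube_poly_loc_size.
have [sP' orth] := cube_polyP s fi'.
rewrite -mpoly.mevalB; apply: is_cube_poly_bound => //.
  exact: (cube_integrableB fi' (cube_integrable_poly Q' P)).
split.
  by rewrite (leq_trans (mpoly.msizeD_le _ _))// geq_max sP' mpoly.msizeN.
move=> b bs; rewrite -[RHS](orth b bs); apply: eq_integral => y _.
by rewrite /poly_eval mpoly.mevalB; congr (_ * _)%:E; ring.
Qed.

End cube_polynomials.

(** * Families indexed by a countable type *)

Section countable_families.
Context {R : realType} {I : countType}.
Implicit Types (P : set I).

(** Turns a family over a countable type into a sequence, with a neutral value at the codes of no
    index in P, so that results on series and on countable unions over nat carry over. *)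
Definition decode_fun T (x0 : T) (P : set I) (F : I -> T) (k : nat) : T :=
  if @pickle_inv I k is Some i then (if i \in P then F i else x0) else x0.

Lemma decode_fun_pickle T (x0 : T) P F i :
  decode_fun x0 P F (pickle i) = if i \in P then F i else x0.
Proof. by rewrite /decode_fun pickleK_inv. Qed.

Lemma decode_funP T (x0 : T) P F k :
  (exists i, [/\ P i, k = pickle i & decode_fun x0 P F k = F i]) \/
  decode_fun x0 P F k = x0.
Proof.
rewrite /decode_fun; have := @pickle_invK I k; case: (pickle_inv k) => [i|]/=; last by right.
move=> <-; case: ifPn => [/set_mem Pi|]; last by right.
by left; exists i.
Qed.

Lemma esum_nneseries P (a : I -> \bar R) : (forall i, P i -> (0 <= a i)%E) ->
  (\esum_(i in P) a i = \sum_(k <oo) decode_fun 0 P a k)%E.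
Proof.
move=> a0; have d0 k : (0 <= decode_fun 0 P a k)%E.
  by have [[i [Pi _ ->]]|->//] := decode_funP 0%E P a k; exact: a0.
rewrite nneseries_esumT//.
rewrite (esum_mkcond P).
transitivity (\esum_(k in range (@pickle I)) decode_fun 0 P a k)%E; last first.
  rewrite esum_mkcond; apply: eq_esum => k _.
  case: ifPn => // /negP kr; rewrite /decode_fun.
  have := @pickle_invK I k; case: (pickle_inv k) => [i|]//= ik.
  by exfalso; apply: kr; apply/mem_set; exists i.
rewrite (@reindex_esum _ _ _ setT (range (@pickle I)) (@pickle I))//; last first.
  split.
  - by move=> i _; exists i.
  - by apply: in2W; exact: (pcan_inj pickleK).
  - by move=> _ [i _ <-]; exists i.
by apply: eq_esum => i _; rewrite decode_fun_pickle.
Qed.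

Lemma bigcup_decode_fun T P (F : I -> set T) :
  \bigcup_(i in P) F i = \bigcup_k decode_fun set0 P F k.
Proof.
apply/seteqP; split => x.
  move=> [i Pi Fi]; exists (pickle i) => //.
  by rewrite decode_fun_pickle mem_set.
by move=> [k _]; have [[i [Pi _ ->]]|->//] := decode_funP set0 P F k; exists i.
Qed.

Context {d} {T : measurableType d} (mu : {measure set T -> \bar R}).

Lemma measurable_decode_fun P (F : I -> set T) k :
  (forall i, P i -> measurable (F i)) -> measurable (decode_fun set0 P F k).
Proof.
move=> mF; have [[i [Pi _ ->]]|->//] := decode_funP set0 P F k; exact: mF.
Qed.

Lemma bigcup_countType_measurable P (F : I -> set T) :
  (forall i, P i -> measurable (F i)) -> measurable (\bigcup_(i in P) F i).
Proof.
move=> mF; rewrite bigcup_decode_fun; apply: bigcupT_measurable => k.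
exact: measurable_decode_fun.
Qed.

Lemma measure_bigcup_le_esum P (F : I -> set T) : (forall i, P i -> measurable (F i)) ->
  (mu (\bigcup_(i in P) F i) <= \esum_(i in P) mu (F i))%E.
Proof.
move=> mF; rewrite bigcup_decode_fun esum_nneseries//.
apply: (le_trans (generalized_Boole_inequality _ _ _)).
- by move=> k; exact: measurable_decode_fun.
- by apply: bigcupT_measurable => k; exact: measurable_decode_fun.
apply: lee_nneseries => // k _.
by rewrite /decode_fun; case: pickle_inv => [i|]; [case: ifP|]; rewrite ?measure0.
Qed.

Lemma ge0_integral_bigcup_esum P (F : I -> set T) (f : T -> \bar R) :
  (forall i, P i -> measurable (F i)) ->
  measurable_fun (\bigcup_(i in P) F i) f ->
  (forall x, (\bigcup_(i in P) F i) x -> 0 <= f x)%E ->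
  trivIset P F ->
  (\int[mu]_(x in \bigcup_(i in P) F i) f x = \esum_(i in P) \int[mu]_(x in F i) f x)%E.
Proof.
move=> mF mf f0 tF.
rewrite esum_nneseries => [|i Pi]; last first.
  by apply: integral_ge0 => x Fx; apply: f0; exists i.
rewrite bigcup_decode_fun in mf f0 *.
rewrite ge0_integral_bigcup//.
- apply: eq_eseriesr => k _; rewrite /decode_fun.
  by case: pickle_inv => [i|]; [case: ifP|]; rewrite ?integral_set0.
- by move=> k; exact: measurable_decode_fun.
- move=> k l _ _; have [[i [Pi -> ->]]|->] := decode_funP set0 P F k; last by case=> x [].
  have [[j [Pj -> ->]]|->] := decode_funP set0 P F l; last by case=> x [].
  by move=> /(tF i j Pi Pj) ->.
Qed.

Lemma negligible_bigcup_countType P (F : I -> set T) :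
  (forall i, P i -> mu.-negligible (F i)) -> mu.-negligible (\bigcup_(i in P) F i).
Proof.
move=> nF; rewrite bigcup_decode_fun; apply: negligible_bigcup => k.
have [[i [Pi _ ->]]|->] := decode_funP set0 P F k; first exact: nF.
exact: negligible_set0.
Qed.

Lemma integral_esum (D : set T) P (h : I -> T -> \bar R) : measurable D ->
  (forall i, P i -> measurable_fun D (h i)) ->
  (forall i x, P i -> D x -> (0 <= h i x)%E) ->
  (\int[mu]_(x in D) (\esum_(i in P) h i x) = \esum_(i in P) \int[mu]_(x in D) h i x)%E.
Proof.
move=> mD mh h0.
rewrite esum_nneseries => [|i Pi]; last by apply: integral_ge0 => x; exact: h0.
transitivity (\int[mu]_(x in D) \sum_(k <oo) decode_fun (cst 0) P h k x)%E.
  apply: eq_integral => x /set_mem Dx; rewrite esum_nneseries => [|i Pi]; last exact: h0.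
  apply: eq_eseriesr => k _; rewrite /decode_fun.
  by case: pickle_inv => [i|//]; case: ifP.
rewrite integral_nneseries//.
- apply: eq_eseriesr => k _; rewrite /decode_fun.
  by case: pickle_inv => [i|]; [case: ifP|]; rewrite ?integral0.
- move=> k; have [[i [Pi _ ->]]|->] := decode_funP (cst 0%E) P h k; first exact: mh.
  exact: measurable_cst.
- move=> k x Dx; have [[i [Pi _ ->]]|->//] := decode_funP (cst 0%E) P h k.
  exact: h0.
Qed.

Lemma measurable_fun_esum (D : set T) P (h : I -> T -> \bar R) : measurable D ->
  (forall i, P i -> measurable_fun D (h i)) ->
  (forall i x, P i -> D x -> (0 <= h i x)%E) ->
  measurable_fun D (fun x => \esum_(i in P) h i x)%E.
Proof.
move=> mD mh h0.
apply: (eq_measurable_fun (fun x => \sum_(k <oo) decode_fun (cst 0) P h k x)%E).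
  move=> x /set_mem Dx; rewrite esum_nneseries => [|i Pi]; last exact: h0.
  apply: eq_eseriesr => k _; rewrite /decode_fun.
  by case: pickle_inv => [i|//]; case: ifP.
apply: ge0_emeasurable_sum => [k x Dx _|k _].
  have [[i [Pi _ ->]]|->//] := decode_funP (cst 0%E) P h k.
  exact: h0.
have [[i [Pi _ ->]]|->] := decode_funP (cst 0%E) P h k; first exact: mh.
exact: measurable_cst.
Qed.

Lemma esumZl P (a : I -> \bar R) (c : R) : 0 <= c -> (forall i, P i -> (0 <= a i)%E) ->
  (\esum_(i in P) (c%:E * a i) = c%:E * \esum_(i in P) a i)%E.
Proof.
move=> c0 a0; rewrite !esum_nneseries//; last first.
  by move=> i Pi; rewrite mule_ge0// a0.
rewrite -nneseriesZl//; last first.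
  by move=> k _; have [[i [Pi _ ->]]|->//] := decode_funP 0%E P a k; exact: a0.
apply: eq_eseriesr => k _; rewrite /decode_fun.
by case: pickle_inv => [i|]; [case: ifP|]; rewrite ?mule0.
Qed.

End countable_families.

Lemma esum_bigcup_esum {R : realType} {I J : choiceType} (P : set I) (F : I -> set J)
    (a : J -> \bar R) : trivIset P F -> (forall j, 0 <= a j)%E ->
  (\esum_(j in \bigcup_(i in P) F i) a j = \esum_(i in P) \esum_(j in F i) a j)%E.
Proof.
move=> tF a0; rewrite esum_esum//.
rewrite (@reindex_esum _ _ _ (P `*`` F) (\bigcup_(i in P) F i) snd)//.
split=> [[i j] [Pi Fj]|[i j] [i' j'] /set_mem[/= Pi Fj] /set_mem[/= Pi' Fj'] jj'|j [i Pi Fj]].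
- by exists i.
- by rewrite -jj' in Fj' *; rewrite (tF i i' Pi Pi')//; exists j.
- by exists (i, j).
Qed.

(** * Dyadic cubes *)

Lemma not_iff_setY T (A B : set T) x : ~ (A x <-> B x) -> (A `+` B) x.
Proof.
have [Ax|Ax] := pselect (A x); have [Bx|Bx] := pselect (B x) => nAB.
- by exfalso; apply: nAB.
- by left; split.
- by right; split.
- by exfalso; apply: nAB.
Qed.

Section dyadic_cubes.
Context {R : realType} {n : nat}.
Local Notation mu := (@lebesgue_n R n).
Local Notation word := (seq {ffun 'I_n -> bool}).
Implicit Types (Q : cube R n) (e : {ffun 'I_n -> bool}) (u v w : word).

Lemma half_side_gt0 Q : 0 < side Q / 2.
Proof. by rewrite divr_gt0// side_gt0. Qed.

(** Points on a midplane go to the upper half, and outer faces are inherited. The children thus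
    partition Q exactly, whichever faces Q contains, and no null sets of faces need to be
    discarded. *)
Definition child Q e : cube R n :=
  Cube (fun i => corner Q i + (if e i then side Q / 2 else 0)) (half_side_gt0 Q)
       (fun i => e i || lclosed Q i) (fun i => e i && rclosed Q i).

(* Words are read from the right: the last letter picks the first generation. *)
Fixpoint cube_at Q w : cube R n :=
  if w is e :: w' then child (cube_at Q w') e else Q.

Lemma edge_child Q e i t : (t \in edge (child Q e) i) =
  (t \in edge Q i) && (e i == (corner Q i + side Q / 2 <= t)).
Proof.
have h2 : side Q / 2 + side Q / 2 = side Q by lra.
have hp := half_side_gt0 Q.
rewrite /edge/= !in_itv/=; case: (e i); rewrite /= ?addr0.
  rewrite -addrA h2; case: leP => h; rewrite ?andbF ?andbT//=.
  suff -> : corner Q i < t ?<= if lclosed Q i by [].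
  have ct : corner Q i < t by apply: lt_le_trans h; rewrite ltrDl.
  by case: lclosed => //=; exact: ltW.
rewrite [t < _ + _ / 2]ltNge.
have [h|h] := leP (corner Q i + side Q / 2) t; rewrite /= ?andbF ?andbT//.
suff -> : t < corner Q i + side Q ?<= if ~~ ~~ rclosed Q i by rewrite andbT.
have tc : t < corner Q i + side Q.
  by rewrite (lt_trans h)// ltrD2l -[X in _ < X]h2 ltrDl.
by case: rclosed => //=; exact: ltW.
Qed.

Lemma set_of_child Q e x : set_of_cube (child Q e) x <->
  set_of_cube Q x /\ forall i, e i = (corner Q i + side Q / 2 <= coord x i).
Proof.
split=> [H|[H1 H2] i].
  by split=> i; have := H i; rewrite edge_child => /andP[// _ /eqP].
by rewrite edge_child (H1 i) H2 eqxx.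
Qed.

Lemma child_sub Q e : set_of_cube (child Q e) `<=` set_of_cube Q.
Proof. by move=> x /set_of_child[]. Qed.

Lemma child_cover Q x : set_of_cube Q x -> exists e, set_of_cube (child Q e) x.
Proof.
move=> Qx; exists [ffun i => corner Q i + side Q / 2 <= coord x i].
by apply/set_of_child; split=> // i; rewrite ffunE.
Qed.

Lemma child_inj Q e e' x :
  set_of_cube (child Q e) x -> set_of_cube (child Q e') x -> e = e'.
Proof.
by move=> /set_of_child[_ h] /set_of_child[_ h']; apply/ffunP => i; rewrite h h'.
Qed.

Lemma cube_vol_child Q e : cube_vol Q = 2 ^+ n * cube_vol (child Q e).
Proof. by rewrite !cube_volE/= -exprMn mulrC divfK. Qed.

Lemma cube_at_cat Q u v : cube_at Q (u ++ v) = cube_at (cube_at Q v) u.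
Proof. by elim: u => //= e u ->. Qed.

Lemma cube_at_sub Q w : set_of_cube (cube_at Q w) `<=` set_of_cube Q.
Proof. by elim: w => //= e w IH x /child_sub/IH. Qed.

Lemma cube_at_cat_sub Q u v :
  set_of_cube (cube_at Q (u ++ v)) `<=` set_of_cube (cube_at Q v).
Proof. by rewrite cube_at_cat; exact: cube_at_sub. Qed.

Lemma side_cube_at Q w : side (cube_at Q w) = side Q / 2 ^+ size w.
Proof.
elim: w => [|e w IH] /=; first by rewrite expr0 divr1.
by rewrite IH exprS invfM mulrCA mulrC mulrA.
Qed.

Lemma side_cube_at_le Q w : side (cube_at Q w) <= side Q.
Proof.
rewrite side_cube_at ler_pdivrMr ?exprn_gt0// ler_peMr ?(ltW (side_gt0 _))//.
by rewrite exprn_ege1// ler1n.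
Qed.

Lemma cube_at_cover Q N x : set_of_cube Q x ->
  exists2 w, size w = N & set_of_cube (cube_at Q w) x.
Proof.
move=> Qx; elim: N => [|N [w wN wx]]; first by exists [::].
by have [e ex] := child_cover wx; exists (e :: w); rewrite //= wN.
Qed.

Lemma cube_at_inj Q w w' x : size w = size w' ->
  set_of_cube (cube_at Q w) x -> set_of_cube (cube_at Q w') x -> w = w'.
Proof.
elim: w w' => [|e w IH] [|e' w']//= [ww'] xw xw'.
have eqw := IH _ ww' (child_sub xw) (child_sub xw').
by rewrite eqw in xw *; rewrite (child_inj xw xw').
Qed.

(** The last [size w] letters of [w'] name a cube of the generation of [w] that also contains x,
    hence they are [w]. *)
Lemma cube_at_nested Q w w' x : (size w <= size w')%N ->
  set_of_cube (cube_at Q w) x -> set_of_cube (cube_at Q w') x ->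
  exists u, w' = u ++ w.
Proof.
move=> ww' xw xw'; exists (take (size w' - size w) w').
rewrite -[LHS](cat_take_drop (size w' - size w)); congr cat.
apply: (@cube_at_inj Q _ _ x) => //; first by rewrite size_drop subKn.
move: xw'; rewrite -{1}(cat_take_drop (size w' - size w) w').
exact: cube_at_cat_sub.
Qed.

(** Inside Q, the set U is a union of cells of generation N; outside Q it is arbitrary. *)
Definition dyadic_level Q N (U : set (euclid R n)) := forall w, size w = N ->
  forall x y, set_of_cube (cube_at Q w) x -> set_of_cube (cube_at Q w) y -> U x -> U y.

(* Borel sets turn out to be approximable in measure by unions of dyadic cells of
   one generation, which is what replaces the topological regularity of the
   measure in the differentiation theorem. *)
Definition cell_approx Q (B : set (euclid R n)) :=
  measurable B /\ forall delta : R, 0 < delta -> exists N U,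
    [/\ dyadic_level Q N U, measurable U &
        (mu (set_of_cube Q `&` (B `+` U)) <= delta%:E)%E].

Lemma dyadic_levelW Q N N' U : (N <= N')%N -> dyadic_level Q N U -> dyadic_level Q N' U.
Proof.
move=> NN' lU w wN x y; rewrite -(cat_take_drop (N' - N) w) => /cube_at_cat_sub wx /cube_at_cat_sub wy.
by apply: (lU (drop (N' - N) w)) => //; rewrite size_drop wN subKn.
Qed.

(** The hypotheses say that [op] is a pointwise Boolean operation. If U and V approximate A and B,
    then [op A B] and [op U V] can differ only where A differs from U or B from V. Both
    approximations are first brought to a common generation. *)
Lemma cell_approx_op Q (op : set (euclid R n) -> set (euclid R n) -> set (euclid R n)) A B :
  (forall A B, measurable A -> measurable B -> measurable (op A B)) ->
  (forall A B A' B' x, (A x <-> A' x) -> (B x <-> B' x) -> op A B x -> op A' B' x) ->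
  (forall A B x y, (A x <-> A y) -> (B x <-> B y) -> op A B x -> op A B y) ->
  cell_approx Q A -> cell_approx Q B -> cell_approx Q (op A B).
Proof.
move=> mop congop congpt [mA apA] [mB apB]; split; first exact: mop.
move=> d d0; have d2 : 0 < d / 2 by rewrite divr_gt0.
have [N [U [lU mU AU]]] := apA _ d2; have [N' [V [lV mV BV]]] := apB _ d2.
have {}lU := dyadic_levelW (leq_maxl N N') lU.
have {}lV := dyadic_levelW (leq_maxr N N') lV.
have mQ := measurable_set_of_cube Q.
have mY (C D : set (euclid R n)) : measurable C -> measurable D -> measurable (C `+` D).
  by move=> mC mD; apply: measurableU; apply: measurableD.
exists (maxn N N'), (op U V); split.
- move=> w wN x y wx wy; apply: congpt; split.
  + exact: (lU w wN x y). + exact: (lU w wN y x).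
  + exact: (lV w wN x y). + exact: (lV w wN y x).
- exact: mop.
have dd : d%:E = ((d / 2)%:E + (d / 2)%:E)%E by rewrite -EFinD; congr EFin; lra.
rewrite dd; apply: le_trans (leeD AU BV).
apply: le_trans (measureU2 _ _ _); last 2 first.
- by apply: measurableI => //; exact: mY.
- by apply: measurableI => //; exact: mY.
apply: le_measure; rewrite ?inE.
- by apply: measurableI => //; apply: mY; exact: mop.
- by apply: measurableU; apply: measurableI => //; exact: mY.
move=> x [Qx ABx].
have [AxU|AxU] := pselect (A x <-> U x); last first.
  by left; split => //; exact: not_iff_setY.
have [BxV|BxV] := pselect (B x <-> V x); last first.
  by right; split => //; exact: not_iff_setY.
exfalso; case: ABx => -[h1 h2]; apply: h2.
- exact: congop h1.
- by apply: (congop U V); rewrite ?AxU ?BxV.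
Qed.

Lemma cell_approx_level Q N U : dyadic_level Q N U -> measurable U -> cell_approx Q U.
Proof.
move=> lU mU; split => // d d0; exists N, U; split => //.
by rewrite /setY setDv setU0 setI0 measure0 lee_fin ltW.
Qed.

(** Q has finite measure, so by continuity from above the part of the union missed by [F i] in Q
    becomes small, and an approximation of that single [F i] suffices. *)
Lemma cell_approx_ndseq Q (F : (set (euclid R n))^nat) :
  nondecreasing_seq F -> (forall i, cell_approx Q (F i)) ->
  cell_approx Q (\bigcup_i F i).
Proof.
move=> ndF aF; have mF i : measurable (F i) by have [] := aF i.
have mUF : measurable (\bigcup_i F i) by exact: bigcupT_measurable.
split => // d d0; have d2 : 0 < d / 2 by rewrite divr_gt0.
have mQ := measurable_set_of_cube Q.
pose G i := set_of_cube Q `&` (\bigcup_i F i `\` F i).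
have mG i : measurable (G i) by apply: measurableI => //; exact: measurableD.
have G0 : \bigcap_i G i = set0.
  rewrite -subset0 => x Gx; have [_ [[i _ Fix] _]] := Gx 0%N I.
  by have [_ [_ ]] := Gx i I.
have cvgG : mu \o G @ \oo --> mu (\bigcap_i G i).
  apply: nonincreasing_cvg_mu => //.
  - apply: (@le_lt_trans _ _ (mu (set_of_cube Q))); last by rewrite lebesgue_n_cube ltry.
    by apply: le_measure; rewrite ?inE// => x [].
  - by rewrite G0; exact: measurable0.
  - move=> i j ij; apply/subsetPset => x [Qx [Fx nFx]]; split => //; split => // Fix; apply: nFx.
    by move: x Fix {Qx Fx}; apply/subsetPset/ndF.
rewrite G0 measure0 in cvgG.
have [i Gi] : exists i, (mu (G i) <= (d / 2)%:E)%E.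
  have /fine_cvgP[fG /cvgrPdist_le /(_ _ d2) [N _ NP]] := cvgG.
  have [N' _ N'P] := fG; exists (maxn N N').
  have := NP (maxn N N') (leq_maxl _ _); have := N'P (maxn N N') (leq_maxr _ _).
  rewrite /= sub0r normrN => fin; rewrite ger0_norm ?fine_ge0//.
  by rewrite -lee_fin fineK.
have [_ /(_ _ d2)[N [U [lU mU FU]]]] := aF i.
exists N, U; split => //.
have dd : d%:E = ((d / 2)%:E + (d / 2)%:E)%E by rewrite -EFinD; congr EFin; lra.
have mY (C D : set (euclid R n)) : measurable C -> measurable D -> measurable (C `+` D).
  by move=> mC mD; apply: measurableU; apply: measurableD.
rewrite dd; apply: le_trans (leeD Gi FU).
apply: le_trans (measureU2 _ _ _) => //; last first.
  by apply: measurableI => //; exact: mY.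
apply: le_measure; rewrite ?inE.
- by apply: measurableI => //; exact: mY.
- by apply: measurableU => //; apply: measurableI => //; exact: mY.
move=> x [Qx [[UFx nUx]|[Ux nUFx]]].
  by have [Fix|nFix] := pselect (F i x); [right; split => //; left|left].
by right; split => //; right; split => // Fix; apply: nUFx; exists i.
Qed.

End dyadic_cubes.

(** * Dyadic differentiation *)

Section dyadic_differentiation.
Context {R : realType} {n : nat}.
Local Notation mu := (@lebesgue_n R n).
Local Notation word := (seq {ffun 'I_n -> bool}).
Implicit Types (Q : cube R n) (u v w : word).

Lemma cell_approx_sigma_algebra Q : sigma_algebra setT (@cell_approx R n Q).
Proof.
apply/sigma_algebraP; first by move=> ? _.
split.
- by apply: (@cell_approx_level _ _ _ 0%N) => //.
- move=> A B _; apply: cell_approx_op.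
  + exact: measurableD.
  + by move=> {A}A {}B A' B' x AA BB [Ax nBx]; split; [exact/AA|move/BB].
  + by move=> {A}A {}B x y AA BB [Ax nBx]; split; [exact/AA|move/BB].
- exact: cell_approx_ndseq.
- move=> A B; apply: cell_approx_op.
  + exact: measurableI.
  + by move=> {A}A {}B A' B' x AA BB [Ax Bx]; split; [exact/AA|exact/BB].
  + by move=> {A}A {}B x y AA BB [Ax Bx]; split; [exact/AA|exact/BB].
Qed.

Lemma edge_dist Q i x y : set_of_cube Q x -> set_of_cube Q y ->
  coord y i <= coord x i + side Q.
Proof.
move=> /(_ i); rewrite in_itv/= => /andP[x1 _] /(_ i); rewrite in_itv/= => /andP[_ y2].
have : corner Q i <= coord x i by move: x1; case: lclosed => //=; exact: ltW.
have : coord y i <= corner Q i + side Q by move: y2; case: rclosed => //=; exact: ltW.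
lra.
Qed.

(** In Q, the open half-space is the increasing union over N of the cells of generation N that it
    contains. The part outside Q is added to every stage, where [dyadic_level] does not see it. *)
Lemma cell_approx_ray Q i (a : R) : cell_approx Q [set x | coord x i < a].
Proof.
set B := mkset _.
have mB : measurable B.
  rewrite (_ : B = (@coord R n ^~ i) @^-1` `]-oo, a[).
    by rewrite -[X in measurable X]setTI; exact: measurable_coord.
  by apply/seteqP; split => x; rewrite /B/= in_itv.
pose W N := [set w : word | size w = N /\ set_of_cube (cube_at Q w) `<=` B].
pose V N := \bigcup_(w in W N) set_of_cube (cube_at Q w).
have mV N : measurable (V N).
  by apply: bigcup_countType_measurable => w _; exact: measurable_set_of_cube.
have mQ := measurable_set_of_cube Q.
rewrite (_ : B = \bigcup_N (V N `|` (B `\` set_of_cube Q))); last first.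
  apply/seteqP; split => x; last by move=> [N _ [[w [_ wB] /wB//]|[]]].
  move=> Bx; have [Qx|nQx] := pselect (set_of_cube Q x); last by exists 0%N => //; right.
  have ax : 0 < a - coord x i by rewrite subr_gt0.
  (* As N < 2^N, cells of generation N have side less than the distance from x to the boundary of
     the half-space. *)
  pose N := Num.Def.archi_bound (side Q / (a - coord x i)).
  have [w wN wx] := cube_at_cover N Qx.
  exists N => //; left; exists w => //; split => // y wy; rewrite /B/=.
  apply: le_lt_trans (edge_dist i wx wy) _; rewrite -ltrBrDl.
  rewrite side_cube_at wN ltr_pdivrMr ?exprn_gt0// mulrC -ltr_pdivrMr//.
  have := @archi_boundP R (side Q / (a - coord x i)).
  move=> /(_ (divr_ge0 (ltW (side_gt0 Q)) (ltW ax)))/lt_trans; apply.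
  by rewrite -natrX ltr_nat ltn_expl.
apply: cell_approx_ndseq => [N N' NN'|N].
  apply/subsetPset => x [[w [wN wB] wx]|nQ]; last by right.
  have Qx := cube_at_sub wx.
  have [w' wN' wx'] := cube_at_cover N' Qx.
  left; exists w' => //; split => // y.
  have [|u ->] := @cube_at_nested _ _ Q w w' x _ wx wx'; first by rewrite wN wN'.
  by move=> /cube_at_cat_sub/wB.
apply: (@cell_approx_level _ _ _ N); last by apply: measurableU => //; exact: measurableD.
move=> w wN x y wx wy [[w' [wN' wB] wx']|[_ nQx]]; last by have := cube_at_sub wx.
left; exists w' => //; rewrite (@cube_at_inj _ _ Q w' w x) ?wN ?wN'//.
Qed.

Lemma cell_approx_measurable Q (B : set (euclid R n)) : measurable B -> cell_approx Q B.
Proof.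
have [aset0 aC aU] := cell_approx_sigma_algebra Q.
suff H : g_sigma_preimage (fun i (x : euclid R n) => tnth x i) `<=` @cell_approx R n Q.
  by move=> mB; apply: H.
apply: smallest_sub; first exact: cell_approx_sigma_algebra.
elim/big_ind : _ => [//|A C AC CC|i _]; first by rewrite subUset.
move=> _ [A mA <-]; rewrite setTI.
suff H : (@RGenInftyO.G R).-sigma.-measurable `<=`
    [set A | cell_approx Q ((fun x : euclid R n => tnth x i) @^-1` A)].
  by apply: H; rewrite -RGenInftyO.measurableE.
apply: smallest_sub; last first.
  move=> _ [a ->] /=.
  rewrite (_ : _ @^-1` _ = [set x | coord x i < a]); first exact: cell_approx_ray.
  by apply/seteqP; split => x /=; rewrite in_itv.
split => /=.
- by rewrite preimage_set0.
- by move=> C /aC; rewrite !setTD preimage_setC.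
- by move=> F aF; rewrite preimage_bigcup; exact: aU.
Qed.

(** Up to measure delta, E is a union V of cells of one generation that meet E, so that the mean of
    g on each is at most lam. Hence (lam + eps) |E| <= lam |V| + M delta <= lam (|E| + delta) + M
    delta, and delta is arbitrary. No maximal function or covering lemma is involved. *)
Lemma dyadic_differentiation_bounded Q (g : euclid R n -> R) (lam eps M : R)
    (E : set (euclid R n)) :
  measurable_fun (set_of_cube Q) g -> (forall x, set_of_cube Q x -> 0 <= g x) ->
  0 <= lam -> 0 < eps -> 0 <= M -> measurable E -> E `<=` set_of_cube Q ->
  (forall x, E x -> lam + eps <= g x <= M) ->
  (forall x w, E x -> set_of_cube (cube_at Q w) x ->
    (\int[mu]_(y in set_of_cube (cube_at Q w)) (g y)%:E <= (lam * cube_vol (cube_at Q w))%:E)%E) ->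
  mu E = 0.
Proof.
move=> mg g0 lam0 eps0 M0 mE EQ Eg Ew.
have mQ := measurable_set_of_cube Q.
have Efin : (mu E < +oo)%E.
  apply: (@le_lt_trans _ _ (mu (set_of_cube Q))); last by rewrite lebesgue_n_cube ltry.
  by apply: le_measure; rewrite ?inE.
have Ee : mu E = (fine (mu E))%:E by rewrite fineK// ge0_fin_numE.
suff key (delta : R) : 0 < delta -> eps * fine (mu E) <= (lam + M) * delta.
  rewrite Ee; congr EFin; apply/eqP; rewrite eq_le fine_ge0// andbT.
  rewrite leNgt; apply/negP => E0.
  have d0 : 0 < eps * fine (mu E) / (2 * (lam + M + 1)).
    by rewrite divr_gt0 ?mulr_gt0//; lra.
  have := key _ d0; apply/negP; rewrite -ltNge mulrA ltr_pdivrMr; last lra.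
  rewrite mulrC ltr_pM2l; last exact: mulr_gt0.
  lra.
move=> d0; have [_ /(_ _ d0)[N [U [lU mU EU]]]] := cell_approx_measurable Q mE.
(* Cells with a point of E in U: the point in E bounds the mean of g, and the point in U puts the
   whole cell in U, so that V exceeds E by little. What they miss of E lies outside U. *)
pose W := [set w : word | size w = N /\ exists x, [/\ E x, U x & set_of_cube (cube_at Q w) x]].
pose V := \bigcup_(w in W) set_of_cube (cube_at Q w).
have mw w : measurable (set_of_cube (cube_at Q w)) by exact: measurable_set_of_cube.
have mV : measurable V by apply: bigcup_countType_measurable.
have VQ : V `<=` set_of_cube Q by move=> x [w _ /cube_at_sub].
have VU : V `<=` U.
  by move=> x [w [wN [y [Ey Uy wy]]] wx]; exact: (lU w wN y x).
have tW : trivIset W (fun w => set_of_cube (cube_at Q w)).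
  move=> w w' [wN _] [wN' _] [x [wx wx']].
  by apply: (@cube_at_inj _ _ Q _ _ x); rewrite ?wN ?wN'.
have mEU : measurable (E `\` U) by exact: measurableD.
have EsubVU : E `<=` V `|` (E `\` U).
  move=> x Ex; have [Ux|] := pselect (U x); last by right.
  have [w wN wx] := cube_at_cover N (EQ x Ex).
  by left; exists w => //; split => //; exists x.
have gQ (A : set (euclid R n)) : measurable A -> A `<=` set_of_cube Q ->
    measurable_fun A (EFin \o g).
  by move=> mA AQ; apply/measurable_EFinP; exact: measurable_funS mg.
have h1 : ((lam + eps)%:E * mu E <= \int[mu]_(x in E) (g x)%:E)%E.
  rewrite -integral_cst//; apply: ge0_le_integral => //.
  - by move=> x _; rewrite lee_fin; lra.
  - exact: gQ.
  - by move=> x Ex; rewrite lee_fin; have /andP[] := Eg x Ex.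
have VEQ : V `|` (E `\` U) `<=` set_of_cube Q by move=> x [/VQ//|[/EQ]].
have h2 : (\int[mu]_(x in E) (g x)%:E <=
    \int[mu]_(x in V) (g x)%:E + \int[mu]_(x in E `\` U) (g x)%:E)%E.
  rewrite -ge0_integral_setU//.
  - apply: ge0_subset_integral => //; first exact: measurableU.
      by apply: gQ => //; exact: measurableU.
    by move=> x /VEQ Qx; rewrite lee_fin g0.
  - by apply: gQ => //; exact: measurableU.
  - by move=> x /VEQ Qx; rewrite lee_fin g0.
  - by apply/disj_setPS => x [/VU Ux []].
have h3 : (\int[mu]_(x in V) (g x)%:E <= lam%:E * mu V)%E.
  rewrite -integral_cst// !ge0_integral_bigcup_esum//.
  - apply: le_esum => w [wN [x [Ex Ux wx]]]; apply: (le_trans (Ew x w Ex wx)).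
    by rewrite integral_cst// [X in (_ <= _ * X)%E](lebesgue_n_cube_vol _) EFinM.
  - exact: gQ.
  - by move=> x /VQ Qx; rewrite lee_fin g0.
have EUd : (mu (E `\` U) <= delta%:E)%E.
  apply: le_trans EU; apply: le_measure; rewrite ?inE//.
  - by apply: measurableI => //; apply: measurableU; exact: measurableD.
  - by move=> x [Ex nUx]; split; [exact: EQ|left].
have h4 : (\int[mu]_(x in E `\` U) (g x)%:E <= M%:E * delta%:E)%E.
  apply: (@le_trans _ _ (M%:E * mu (E `\` U))%E); last exact: lee_wpmul2l.
  rewrite -integral_cst//; apply: ge0_le_integral => //.
  - by move=> x [/EQ Qx _]; rewrite lee_fin g0.
  - by apply: gQ => // x [/EQ].
  - by move=> x [Ex _]; rewrite lee_fin; have /andP[] := Eg x Ex.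
have h5 : (mu V <= mu E + delta%:E)%E.
  apply: (@le_trans _ _ (mu E + mu (set_of_cube Q `&` (E `+` U)))%E); last exact: leeD2l.
  have mY : measurable (set_of_cube Q `&` (E `+` U)).
    by apply: measurableI => //; apply: measurableU; exact: measurableD.
  apply: le_trans (measureU2 _ _ _) => //.
  apply: le_measure; rewrite ?inE//; first exact: measurableU.
  move=> x Vx; have [Ex|nEx] := pselect (E x); [by left|right].
  by split; [exact: VQ|right; split => //; exact: VU].
have : ((lam + eps)%:E * mu E <= lam%:E * (mu E + delta%:E) + M%:E * delta%:E)%E.
  apply: (le_trans h1); apply: (le_trans h2); apply: leeD h4.
  by apply: (le_trans h3); apply: lee_wpmul2l.
set m := fine (mu E); rewrite (_ : mu E = m%:E)//.
move=> h; have {}h : (lam + eps) * m <= lam * (m + delta) + M * delta by rewrite -lee_fin.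
have -> : (lam + M) * delta = lam * (m + delta) + M * delta - lam * m by ring.
by rewrite lerBrDr -mulrDl [eps + lam]addrC.
Qed.

(** The one-sided form that stopping needs: almost everywhere, if all dyadic means around x are at
    most lam, then so is g x. The exceptional set is exhausted by the sets where lam + 1/(k+1) <= g
    <= k. *)
Lemma dyadic_differentiation Q (g : euclid R n -> R) (lam : R) :
  measurable_fun (set_of_cube Q) g -> (forall x, set_of_cube Q x -> 0 <= g x) ->
  0 <= lam ->
  mu.-negligible [set x | [/\ set_of_cube Q x, lam < g x &
    forall w, set_of_cube (cube_at Q w) x ->
    (\int[mu]_(y in set_of_cube (cube_at Q w)) (g y)%:E <= (lam * cube_vol (cube_at Q w))%:E)%E]].
Proof.
move=> mg g0 lam0; have mQ := measurable_set_of_cube Q.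
pose good w := (\int[mu]_(y in set_of_cube (cube_at Q w)) (g y)%:E <= (lam * cube_vol (cube_at Q w))%:E)%E.
pose G := set_of_cube Q `\` \bigcup_(w in [set w | ~~ good w]) set_of_cube (cube_at Q w).
have mG : measurable G.
  apply: measurableD => //; apply: bigcup_countType_measurable => w _.
  exact: measurable_set_of_cube.
pose E k := G `&` (set_of_cube Q `&` g @^-1` `[lam + k.+1%:R^-1, k%:R]).
have mE k : measurable (E k) by apply: measurableI => //; exact: mg.
have E0 k : mu (E k) = 0.
  apply: (@dyadic_differentiation_bounded Q g lam k.+1%:R^-1 k%:R) => //.
  - by move=> x [[]].
  - by move=> x [_ []]; rewrite /= in_itv.
  - move=> x w [[_ nx] _] wx; apply: contrapT => /negP ng.
    by apply: nx; exists w.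
apply: (@negligibleS _ _ _ _ (\bigcup_k E k)); last first.
  by apply: negligible_bigcup => k; exists (E k); split; [exact: mE|exact: E0|].
move=> x [Qx lg gx]; have gl : 0 < g x - lam by rewrite subr_gt0.
pose k := maxn (Num.Def.archi_bound (g x)) (Num.Def.archi_bound (g x - lam)^-1).
exists k => //; split.
  split => // -[w /negP ng wx]; apply: ng; exact: gx.
split => //=; rewrite in_itv/=; apply/andP; split; last first.
  rewrite (le_trans (ltW (archi_boundP (g0 x Qx))))// ler_nat leq_maxl//.
rewrite -lerBrDl -[leRHS]invrK lef_pV2 ?posrE ?invr_gt0//.
have := @archi_boundP R (g x - lam)^-1; rewrite invr_ge0 (ltW gl) => /(_ isT)/ltW/le_trans; apply.
by rewrite ler_nat (leq_trans (leq_maxr _ _) (leqnSn _)).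
Qed.

End dyadic_differentiation.

(** * Stopping cubes *)

Section stopping_cubes.
Context {R : realType} {n : nat}.
Local Notation mu := (@lebesgue_n R n).
Local Notation letter := {ffun 'I_n -> bool}.
Local Notation word := (seq letter).
Variables (s : nat) (c0 : R) (f : euclid R n -> R) (Q : cube R n).
Hypothesis fi : cube_integrable Q f.
Implicit Types (u v w : word) (e : letter).

Definition poly_at w := cube_poly_loc s c0 (cube_at Q w) f.

Definition resid w x : R := `|f x - poly_eval (poly_at w) x|.

Definition mean_resid v w : R := (cube_vol (cube_at Q w))^-1 *
  \int[mu]_(x in set_of_cube (cube_at Q w)) resid v x.

Definition osc w := mean_resid w w.

(* The stopping cubes are the dyadic cubes on which the mean of |f - P_v|, for
   the previous stopping cube v, first exceeds twice the oscillation on v;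
   anchor w is the last stopping cube containing the cube of w. *)
Fixpoint anchor w : word :=
  if w is e :: w' then
    if 2 * osc (anchor w') < mean_resid (anchor w') w then w else anchor w'
  else [::].

Definition stops e w := 2 * osc (anchor w) < mean_resid (anchor w) (e :: w).

Fixpoint gen w : nat :=
  if w is e :: w' then if stops e w' then (gen w').+1 else gen w' else 0.

Lemma anchor_cons e w : anchor (e :: w) = if stops e w then e :: w else anchor w.
Proof. by []. Qed.

Lemma gen_cons e w : gen (e :: w) = if stops e w then (gen w).+1 else gen w.
Proof. by []. Qed.

Lemma resid_integrable w w' : cube_integrable (cube_at Q w') (resid w).
Proof.
have fi' := cube_integrableS (@cube_at_sub _ _ Q w') fi.
have h := cube_integrableB fi' (cube_integrable_poly (cube_at Q w') (poly_at w)).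
exact: (integrable_norm h).
Qed.

Lemma resid_triangle v w x :
  resid v x <= `|poly_eval (poly_at w) x - poly_eval (poly_at v) x| + resid w x.
Proof. by rewrite addrC; exact: ler_distD. Qed.

Lemma resid_ge0 w x : 0 <= resid w x. Proof. exact: normr_ge0. Qed.

Lemma Rintegral_resid v w : \int[mu]_(x in set_of_cube (cube_at Q w)) resid v x =
  cube_vol (cube_at Q w) * mean_resid v w.
Proof. by rewrite /mean_resid mulVKf// gt_eqF// cube_vol_gt0. Qed.

Lemma integral_resid v w : (\int[mu]_(x in set_of_cube (cube_at Q w)) (resid v x)%:E =
  (cube_vol (cube_at Q w) * mean_resid v w)%:E)%E.
Proof.
rewrite -Rintegral_resid /Rintegral fineK//; apply: integrable_fin_num.
  exact: measurable_set_of_cube.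
exact: resid_integrable.
Qed.

Lemma mean_resid_ge0 v w : 0 <= mean_resid v w.
Proof.
rewrite mulr_ge0//; first by rewrite invr_ge0 ltW// cube_vol_gt0.
by apply: Rintegral_ge0 => x _; exact: resid_ge0.
Qed.

Lemma osc_ge0 w : 0 <= osc w. Proof. exact: mean_resid_ge0. Qed.

Lemma Rintegral_resid_le u v w :
  cube_vol (cube_at Q (u ++ w)) * mean_resid v (u ++ w) <=
  cube_vol (cube_at Q w) * mean_resid v w.
Proof.
rewrite -lee_fin -!integral_resid; apply: ge0_subset_integral.
- exact: measurable_set_of_cube.
- exact: measurable_set_of_cube.
- exact: (measurable_int _ (resid_integrable v w)).
- by move=> x _; rewrite lee_fin resid_ge0.
- exact: cube_at_cat_sub.
Qed.

Lemma anchor_suffix w : exists u, w = u ++ anchor w.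
Proof.
elim: w => [|e w [u uw]]; first by exists [::].
rewrite anchor_cons; case: ifP => _; first by exists [::].
by exists (e :: u); rewrite {1}uw.
Qed.

Lemma anchor_idem w : anchor (anchor w) = anchor w.
Proof.
elim: w => [//|e w IH]; rewrite anchor_cons; case: ifP => // h.
by rewrite anchor_cons h.
Qed.

Lemma gen_anchor w : gen (anchor w) = gen w.
Proof.
elim: w => [//|e w IH]; rewrite anchor_cons [gen (e :: w)]/=; case: ifP => // h.
by rewrite /= h.
Qed.

Lemma gen_cat u w : (gen w <= gen (u ++ w))%N.
Proof.
elim: u => [//|e u IH] /=; case: ifP => // _; exact: leq_trans IH _.
Qed.

Lemma anchor_fix_stops e w : anchor (e :: w) = e :: w -> stops e w.
Proof.
rewrite anchor_cons; case: ifP => // _ h.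
have [u uw] := anchor_suffix w; rewrite h in uw.
by have := congr1 size uw; rewrite size_cat /=; lia.
Qed.

(** Either the cube of w is its own anchor and the mean is the oscillation, or the stopping test
    failed on it. *)
Lemma mean_resid_anchor w : mean_resid (anchor w) w <= 2 * osc (anchor w).
Proof.
case: w => [|e w]; first by rewrite -/(osc [::]); have := osc_ge0 [::]; lra.
rewrite anchor_cons; case: ifPn => [h|]; last by rewrite -leNgt.
by rewrite -/(osc (e :: w)); have := osc_ge0 (e :: w); lra.
Qed.

(** Stopping cubes do not overshoot: the bound holds on the parent, and a child has 2^-n of its
    volume. *)
Lemma mean_resid_child e w :
  mean_resid (anchor w) (e :: w) <= 2 ^+ n * 2 * osc (anchor w).
Proof.
have := Rintegral_resid_le [:: e] (anchor w) w; rewrite /= (cube_vol_child (cube_at Q w) e).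
have V0 : 0 < cube_vol (child (cube_at Q w) e) by exact: cube_vol_gt0.
move=> h; have {}h : mean_resid (anchor w) (e :: w) <= 2 ^+ n * mean_resid (anchor w) w.
  by rewrite -(ler_pM2l V0) [leRHS]mulrA [_ * 2 ^+ n]mulrC.
apply: (le_trans h); rewrite -mulrA ler_wpM2l ?exprn_ge0//.
exact: mean_resid_anchor.
Qed.

Lemma poly_at_diff e w x : set_of_cube (cube_at Q (e :: w)) x ->
  `|poly_eval (poly_at (e :: w)) x - poly_eval (poly_at (anchor w)) x| <=
  @proj_const R n s * (2 ^+ n * 2) * osc (anchor w).
Proof.
move=> xw; have C0 : 0 < @proj_const R n s by rewrite exprn_gt0// poly_const_gt0.
have [u uw] := anchor_suffix w.
have euw : e :: w = (e :: u) ++ anchor w by rewrite {1}uw.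
have Va := cube_vol_gt0 (cube_at Q (e :: w)).
have := @cube_poly_loc_diff R n s c0 (cube_at Q (anchor w)) (cube_at Q (e :: w)) f x.
move=> /(_ (cube_integrableS (@cube_at_sub _ _ Q _) fi)) H.
have {}H : `|poly_eval (poly_at (e :: w)) x - poly_eval (poly_at (anchor w)) x| *
    cube_vol (cube_at Q (e :: w)) <= @proj_const R n s *
    (cube_vol (cube_at Q (e :: w)) * mean_resid (anchor w) (e :: w)).
  have s1 : set_of_cube (cube_at Q (e :: w)) `<=` set_of_cube (cube_at Q (anchor w)).
    by rewrite euw; exact: cube_at_cat_sub.
  have s2 : side (cube_at Q (e :: w)) <= side (cube_at Q (anchor w)).
    by rewrite euw cube_at_cat side_cube_at_le.
  by rewrite -Rintegral_resid; exact: H s1 s2 xw.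
rewrite [leRHS]mulrCA [leRHS]mulrC ler_pM2r// in H; apply: (le_trans H).
by rewrite -mulrA ler_wpM2l ?(ltW C0)//; exact: mean_resid_child.
Qed.

Definition stopped k := [set w | anchor w = w /\ gen w = k].

(** Intersecting dyadic cubes are nested, and a stopping cube properly inside another has passed at
    least one more stop, so its generation is larger. *)
Lemma stopped_disjoint k : trivIset (stopped k) (fun w => set_of_cube (cube_at Q w)).
Proof.
suff H w w' x : stopped k w -> stopped k w' -> (size w <= size w')%N ->
    set_of_cube (cube_at Q w) x -> set_of_cube (cube_at Q w') x -> w = w'.
  move=> w w' kw kw' [x [xw xw']].
  by case/orP: (leq_total (size w) (size w')) => ww; [|apply/esym]; apply: (H _ _ x).
move=> [_ gw] [aw' gw'] ww xw xw'.
have [[//|e u] uw] := cube_at_nested ww xw xw'.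
rewrite uw cat_cons in aw' gw' *; have st := anchor_fix_stops aw'.
move: gw'; rewrite /= st => gw'.
have := gen_cat u w; rewrite gw; lia.
Qed.

Definition next_stops v := [set w | exists e w', [/\ w = e :: w', anchor w' = v & stops e w']].

Lemma next_stops_stopped k v : stopped k v -> next_stops v `<=` stopped k.+1.
Proof.
move=> [_ gv] _ [e [w [-> aw st]]]; split; first by rewrite anchor_cons st.
by rewrite /= st -gv -aw gen_anchor.
Qed.

Lemma next_stops_sub v w : next_stops v w ->
  set_of_cube (cube_at Q w) `<=` set_of_cube (cube_at Q v).
Proof.
move=> [e [w' [-> <- _]]]; have [u uw] := anchor_suffix w'.
by rewrite {1}uw -cat_cons; exact: cube_at_cat_sub.
Qed.

Lemma stopped_succ k : stopped k.+1 = \bigcup_(v in stopped k) next_stops v.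
Proof.
apply/seteqP; split => [w [aw gw]|w [v kv]]; last exact: next_stops_stopped.
case: w aw gw => [//|e w] aw; have st := anchor_fix_stops aw.
rewrite /= st => -[gw]; exists (anchor w).
  by split; [exact: anchor_idem|rewrite gen_anchor].
by exists e, w.
Qed.

(** Chebyshev: the next stopping cubes are disjoint subcubes on which |f - P_v| has mean more than 2
    [osc v], while its integral over the cube of v is the volume times [osc v]. *)
Lemma esum_next_stops k v : stopped k v ->
  (\esum_(w in next_stops v) (cube_vol (cube_at Q w))%:E <=
   (cube_vol (cube_at Q v) / 2)%:E)%E.
Proof.
move=> kv; have mw w : measurable (set_of_cube (cube_at Q w)) by exact: measurable_set_of_cube.
have V0 w := cube_vol_gt0 (cube_at Q w).
have tv : trivIset (next_stops v) (fun w => set_of_cube (cube_at Q w)).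
  exact: sub_trivIset (next_stops_stopped kv) (@stopped_disjoint _).
pose D := \bigcup_(w in next_stops v) set_of_cube (cube_at Q w).
have mD : measurable D by apply: bigcup_countType_measurable.
have Dv : D `<=` set_of_cube (cube_at Q v) by move=> x [w /next_stops_sub]; exact.
have mr := measurable_int _ (resid_integrable v v).
have key : (\esum_(w in next_stops v) (cube_vol (cube_at Q w) * mean_resid v w)%:E <=
    (cube_vol (cube_at Q v) * osc v)%:E)%E.
  rewrite (eq_esum (b := fun w => (\int[mu]_(x in set_of_cube (cube_at Q w)) (resid v x)%:E)%E)); last first.
    by move=> w _; rewrite integral_resid.
  rewrite -ge0_integral_bigcup_esum//.
  - rewrite -integral_resid; apply: ge0_subset_integral => //.
    by move=> x _; rewrite lee_fin resid_ge0.
  - exact: measurable_funS mr.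
  - by move=> x _; rewrite lee_fin resid_ge0.
(* With zero oscillation no subcube has a positive mean, so nothing stops; otherwise [osc v] can be
   divided out. *)
have [osc0|osc0] := eqVneq (osc v) 0.
  rewrite (_ : next_stops v = set0) ?esum_set0 ?lee_fin ?divr_ge0// ?(ltW (V0 v))//.
  rewrite -subset0 => w vw; have [e [w' [wE aw st]]] := vw.
  have [u uw] := anchor_suffix w'; rewrite aw in uw.
  have := Rintegral_resid_le (e :: u) v v.
  rewrite cat_cons -uw -wE -/(osc v) osc0 mulr0 pmulr_rle0//.
  by move: st; rewrite /stops aw osc0 mulr0 -wE leNgt => ->.
have {}osc0 : 0 < osc v by rewrite lt_neqAle eq_sym osc0 osc_ge0.
have h2 : ((2 * osc v)%:E * (\esum_(w in next_stops v) (cube_vol (cube_at Q w))%:E) <=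
    (cube_vol (cube_at Q v) * osc v)%:E)%E.
  apply: le_trans key; rewrite -esumZl; last 2 first.
  - by rewrite mulr_ge0// ltW.
  - by move=> w _; rewrite lee_fin ltW.
  apply: le_esum => w [e [w' [-> <- st]]]; rewrite -EFinM lee_fin mulrC.
  by apply: ler_wpM2l; [exact: ltW (V0 _)|exact: ltW st].
have : (0 <= \esum_(w in next_stops v) (cube_vol (cube_at Q w))%:E)%E.
  by apply: esum_ge0 => w _; rewrite lee_fin ltW.
(* The sum is an extended real; finiteness follows from [h2] and has to precede the division. *)
move: h2; case: (esum _ _) => [r| |]//.
- rewrite -EFinM !lee_fin => h _.
  rewrite ler_pdivlMr// -(ler_pM2r osc0); apply: le_trans h.
  by rewrite le_eqVlt; apply/orP; left; apply/eqP; ring.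
- move=> h _; exfalso; move: h; rewrite gt0_muley; last by rewrite lte_fin mulr_gt0.
  by rewrite leNgt ltry.
Qed.

Lemma esum_stopped_vol k : (\esum_(w in stopped k) (cube_vol (cube_at Q w))%:E <=
  (cube_vol Q / 2 ^+ k)%:E)%E.
Proof.
elim: k => [|k IH].
  rewrite (_ : stopped 0 = [set [::]]) ?esum_set1 ?lee_fin ?expr0 ?divr1//.
    by rewrite ltW// cube_vol_gt0.
  apply/seteqP; split => [[|e w]//|_ ->//] [aw].
  by rewrite /= (anchor_fix_stops aw).
rewrite stopped_succ esum_bigcup_esum//; last 2 first.
- move=> v v' _ _ [w [[e [w1 [-> <- _]]]]] [e' [w1' [[_ <-] <- _]]].
  by [].
- by move=> w; rewrite lee_fin ltW// cube_vol_gt0.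
apply: (@le_trans _ _ (\esum_(v in stopped k) ((2^-1)%:E * (cube_vol (cube_at Q v))%:E))%E).
  by apply: le_esum => v kv; rewrite -EFinM mulrC; exact: (esum_next_stops kv).
rewrite esumZl// => [|v _]; last by rewrite lee_fin ltW// cube_vol_gt0.
apply: (@le_trans _ _ ((2^-1)%:E * (cube_vol Q / 2 ^+ k)%:E)%E); first exact: lee_wpmul2l.
by rewrite -EFinM lee_fin exprS invfM mulrCA.
Qed.

End stopping_cubes.

(** * Oscillations, powers of sums and renumbered families *)

Lemma oscillation1E {R : realType} {n : nat} (s : nat) (c0 : R) (f : euclid R n -> R)
    (Q : cube R n) : cube_integrable Q f ->
  oscillation 1 s c0 f Q = ((cube_vol Q)^-1 *
    \int[lebesgue_n n]_(x in set_of_cube Q)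
      `|f x - poly_eval (cube_poly_loc s c0 Q f) x|)%:E.
Proof.
move=> fi; have ri := cube_integrableB fi (cube_integrable_poly Q (cube_poly_loc s c0 Q f)).
have ni : cube_integrable Q (fun x => `|f x - poly_eval (cube_poly_loc s c0 Q f) x|).
  exact: (integrable_norm ri).
rewrite /oscillation invr1 poweRe1; last first.
  rewrite mule_ge0 ?lee_fin ?invr_ge0 ?(ltW (cube_vol_gt0 _))//.
  by apply: integral_ge0 => x _; rewrite lee_fin powR_ge0.
rewrite /cube_mean EFinM; congr (_ * _)%E.
rewrite /Rintegral fineK; last first.
  by apply: integrable_fin_num => //; exact: measurable_set_of_cube.
by apply: eq_integral => x _; rewrite powRr1.
Qed.

Lemma oscillation_cube_at {R : realType} {n : nat} (s : nat) (c0 : R) (f : euclid R n -> R)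
    (Q : cube R n) w : cube_integrable Q f ->
  oscillation 1 s c0 f (cube_at Q w) = (osc s c0 f Q w)%:E.
Proof.
move=> fi; rewrite oscillation1E//.
exact: cube_integrableS (@cube_at_sub _ _ Q w) fi.
Qed.

(** If x is at most a small multiple of y, then x + y <= tau^(1/q) y; otherwise x + y is bounded by
    a multiple of x. The factor of y is paid once per generation, so it must be close to 1: the
    usual 2^(q-1) could outgrow the decay of the generations. *)
Lemma powRD_le {R : realType} (q tau : R) : 0 < q -> 1 < tau ->
  exists2 C : R, 0 < C & forall x y, 0 <= x -> 0 <= y ->
    (x + y) `^ q <= C * x `^ q + tau * y `^ q.
Proof.
move=> q0 tau1; pose th := tau `^ q^-1 - 1.
have th0 : 0 < th.
  have : 1 `^ q^-1 < tau `^ q^-1.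
    by apply: gt0_ltr_powR; rewrite ?nnegrE ?invr_gt0// ltW// (lt_trans ltr01).
  by rewrite powR1 subr_gt0.
have thi0 : 0 < th^-1 by rewrite invr_gt0.
exists ((1 + th^-1) `^ q); first by rewrite powR_gt0// addr_gt0.
move=> x y x0 y0.
have mono a b : 0 <= a -> a <= b -> a `^ q <= b `^ q.
  by move=> a0 ab; apply: ge0_ler_powR; rewrite ?nnegrE ?(ltW q0)// (le_trans a0).
have [xy|yx] := leP x (th * y).
  apply: (@le_trans _ _ ((tau `^ q^-1 * y) `^ q)).
    by apply: mono; [exact: addr_ge0|rewrite -(subrK 1 (tau `^ q^-1)) -/th mulrDl mul1r lerD2r].
  rewrite powRM ?powR_ge0// -powRrM mulVf ?gt_eqF// powRr1; last by rewrite ltW// (lt_trans ltr01).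
  by rewrite lerDr mulr_ge0 ?powR_ge0.
apply: (@le_trans _ _ (((1 + th^-1) * x) `^ q)).
  apply: mono; first exact: addr_ge0.
  by rewrite mulrDl mul1r lerD2l mulrC ler_pdivlMr// mulrC ltW.
rewrite powRM// ?addr_ge0 ?(ltW thi0)//.
by rewrite lerDl mulr_ge0 ?powR_ge0// ltW// (lt_trans ltr01).
Qed.

Lemma euclid_interior_sub {R : realType} {n : nat} (A : set (euclid R n)) :
  euclid_interior A `<=` A.
Proof. by move=> x [e e0]; apply => i; rewrite subrr normr0. Qed.

Lemma euclid_interiorS {R : realType} {n : nat} (A B : set (euclid R n)) :
  A `<=` B -> euclid_interior A `<=` euclid_interior B.
Proof. by move=> AB x [e e0 eA]; exists e => // y /eA/AB. Qed.

(* A family of cubes over any countable type can be renumbered by nat, as the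
   definition of admissible families requires. *)
Lemma admissible_countType {R : realType} {n : nat} {I : countType} (W : set I)
    (C : I -> cube R n) (F : cube R n -> \bar R) (X : domain R n) (Q0 : cube R n) :
  (forall i, W i -> set_of_cube (C i) `<=` set_of_domain X) ->
  trivIset W (fun i => euclid_interior (set_of_cube (C i))) ->
  (forall Q, (0 <= F Q)%E) ->
  exists D Qs, admissible X D Qs /\
    (\esum_(i in W) F (C i) = \esum_(j in D) F (Qs j))%E.
Proof.
move=> CX tC F0; pose Qs k := if @pickle_inv I k is Some i then C i else Q0.
have QsE i : Qs (pickle i) = C i by rewrite /Qs pickleK_inv.
exists (pickle @` W), Qs; split.
  split; first by move=> _ [i Wi <-]; rewrite QsE; exact: CX.
  move=> _ _ [i Wi <-] [j Wj <-]; rewrite !QsE => h.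
  by rewrite (tC i j Wi Wj h).
rewrite (@reindex_esum _ _ _ W (pickle @` W) (@pickle I))//.
  by apply: eq_esum => i _; rewrite QsE.
split.
- by move=> i Wi; exists i.
- by apply: in2W; exact: (pcan_inj pickleK).
- by move=> _ [i Wi <-]; exists i.
Qed.

Lemma powR_le_of {R : realType} (q a b : R) : 0 < q -> a <= b -> 0 <= a -> a `^ q <= b `^ q.
Proof.
by move=> q0 ab a0; apply: ge0_ler_powR; rewrite ?nnegrE ?(ltW q0)// (le_trans a0).
Qed.

(** The arithmetic of one stop in [resid_chain]: T is tau to the generation, [ov] and [rv] are the
    q-th powers of oscillation and residual at the old anchor, [ow] and [rw] those at the new one.
    The reserve J T ov on the left pays for the jump. *)
Lemma chain_step {R : realType} (J T t x0 S ov rv rw ow : R) : 0 <= T ->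
  x0 + J * (T * ov) <= J * S + T * rv -> rv <= J * ov + t * rw ->
  x0 + J * (t * T * ow) <= J * (t * T * ow + S) + t * T * rw.
Proof.
move=> T0 h1 /(ler_wpM2l T0) h2.
have -> : J * (t * T * ow + S) + t * T * rw =
   (J * S + T * (J * ov + t * rw) - J * (T * ov)) + J * (t * T * ow) by ring.
by rewrite lerD2r; lra.
Qed.

Lemma settled_step {R : realType} (J x0 S y w B : R) :
  x0 + J * w <= J * S + y -> y <= B * w -> w <= S -> 0 <= B -> 0 <= J -> 0 <= w ->
  x0 <= (J + B) * S.
Proof.
move=> h1 h2 wS B0 J0 w0; have := ler_wpM2l B0 wS; have := mulr_ge0 J0 w0.
by rewrite mulrDl; lra.
Qed.

(** * Pointwise and integral bounds by the stopping cubes *)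

Section stopping_bound.
(* Otherwise [done] unfolds them when it compares unrelated real expressions. *)
Local Opaque osc mean_resid resid poly_at proj_const.
Context {R : realType} {n : nat}.
Local Notation mu := (@lebesgue_n R n).
Local Notation letter := {ffun 'I_n -> bool}.
Local Notation word := (seq letter).
Variables (s : nat) (c0 : R) (f : euclid R n -> R) (Q : cube R n).
Hypothesis fi : cube_integrable Q f.
Implicit Types (u v w : word) (e : letter).
Local Notation poly_at := (poly_at s c0 f Q).
Local Notation resid := (resid s c0 f Q).
Local Notation mean_resid := (mean_resid s c0 f Q).
Local Notation osc := (osc s c0 f Q).
Local Notation anchor := (anchor s c0 f Q).
Local Notation stops := (stops s c0 f Q).
Local Notation gen := (gen s c0 f Q).
Local Notation stopped := (stopped s c0 f Q).

Variables (q tau Cq : R).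
Hypotheses (q0 : 0 < q) (tau1 : 1 < tau) (Cq0 : 0 < Cq).
Hypothesis powRD_leq : forall x y, 0 <= x -> 0 <= y ->
    (x + y) `^ q <= Cq * x `^ q + tau * y `^ q.

Definition jump_const : R := Cq * (@proj_const R n s * (2 ^+ n * 2)) `^ q.

Definition weight w : R := tau ^+ gen w * osc w `^ q.

Fixpoint anchors w : seq word :=
  if w is e :: w' then if stops e w' then w :: anchors w' else anchors w'
  else [:: [::]].

Lemma tau_gt0 : 0 < tau. Proof. exact: lt_trans ltr01 tau1. Qed.

Lemma weight_ge0 w : 0 <= weight w.
Proof. by rewrite mulr_ge0 ?powR_ge0// exprn_ge0// ltW// tau_gt0. Qed.

Lemma anchorsP w v : v \in anchors w -> anchor v = v /\ exists u, w = u ++ v.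
Proof.
elim: w => [|e w IH] /=; first by rewrite inE => /eqP ->; split => //; exists [::].
have H : v \in anchors w -> anchor v = v /\ exists u, e :: w = u ++ v.
  by move=> /IH[av [u uw]]; split => //; exists (e :: u); rewrite uw.
case: ifPn => [st|_]; last exact: H.
rewrite inE => /orP[/eqP ->|]; last exact: H.
by split; [rewrite anchor_cons st|exists [::]].
Qed.

Lemma anchors_uniq w : uniq (anchors w).
Proof.
elim: w => [//|e w IH] /=; case: ifP => // _ /=; rewrite IH andbT.
apply/negP => /anchorsP[_ [u /(congr1 size)]]; rewrite size_cat /=; lia.
Qed.

Lemma anchor_mem w : anchor w \in anchors w.
Proof.
elim: w => [|e w IH]; first by rewrite inE.
by rewrite anchor_cons /=; case: ifP => // _; rewrite mem_head.
Qed.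

Definition acc w : R := \sum_(v <- anchors w) weight v.

Lemma acc_cons e w : acc (e :: w) = if stops e w then weight (e :: w) + acc w else acc w.
Proof. by rewrite /acc /=; case: ifP => // _; rewrite big_cons. Qed.

(** Invariant along the branch of x. Leaving an anchor costs its own oscillation, so the weight of
    the current anchor is kept as a reserve on the left until the next stop spends it; for the empty
    word this is an equality. *)
Lemma resid_chain w x : set_of_cube (cube_at Q w) x ->
  resid [::] x `^ q + jump_const * weight (anchor w) <=
  jump_const * acc w + tau ^+ gen w * resid (anchor w) x `^ q.
Proof.
have t0 := tau_gt0.
elim: w => [|e w IH] wx.
  by rewrite /acc /= big_seq1 expr0 mul1r addrC.
have {}IH := IH (child_sub wx); rewrite anchor_cons acc_cons gen_cons.
case: ifPn => [st|_]; last exact: IH.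
have jump := poly_at_diff s c0 fi wx.
have tri := le_trans (resid_triangle s c0 f Q (anchor w) (e :: w) x) (lerD jump (lexx _)).
have c10 : 0 <= @proj_const R n s * (2 ^+ n * 2).
  by rewrite !mulr_ge0 ?exprn_ge0// ltW// poly_const_gt0.
have o0 := osc_ge0 s c0 f Q (anchor w).
have r0 := resid_ge0 s c0 f Q (e :: w) x.
have tri2 : resid (anchor w) x `^ q <=
    jump_const * osc (anchor w) `^ q + tau * resid (e :: w) x `^ q.
  have rv0 := resid_ge0 s c0 f Q (anchor w) x.
  move: tri rv0 => /(powR_le_of q0) /[apply] /le_trans; apply.
  rewrite /jump_const -(mulrA Cq) -(powRM _ c10 o0).
  exact: powRD_leq (mulr_ge0 c10 o0) r0.
have wv : weight (anchor w) = tau ^+ gen w * osc (anchor w) `^ q.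
  by rewrite /weight gen_anchor.
have we : weight (e :: w) = tau * tau ^+ gen w * osc (e :: w) `^ q.
  rewrite /weight gen_cons st (exprS tau (gen w)); reflexivity.
rewrite we (exprS tau (gen w)); apply: chain_step tri2; first by rewrite exprn_ge0// ltW.
by rewrite -wv.
Qed.

(** At the last stop the residual left in [resid_chain] is at most twice the oscillation, so it is
    absorbed by the weight of v itself. *)
Lemma resid_settled v x : anchor v = v -> set_of_cube (cube_at Q v) x ->
  resid v x <= 2 * osc v ->
  resid [::] x `^ q <= (jump_const + 2 `^ q) * acc v.
Proof.
move=> av vx rv; have := resid_chain vx; rewrite av => h.
have h2 : tau ^+ gen v * resid v x `^ q <= 2 `^ q * weight v.
  rewrite /weight mulrCA; apply: ler_wpM2l; first by rewrite exprn_ge0// ltW// tau_gt0.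
  rewrite -powRM ?osc_ge0//; apply: ge0_ler_powR; rewrite ?nnegrE ?(ltW q0) ?resid_ge0//.
  by rewrite mulr_ge0 ?osc_ge0.
have h3 : weight v <= acc v.
  rewrite /acc (bigD1_seq v) ?anchors_uniq//=; last by rewrite -{1}av anchor_mem.
  by rewrite lerDl sumr_ge0// => w _; exact: weight_ge0.
have J0 : 0 <= jump_const by rewrite mulr_ge0 ?powR_ge0// ltW.
exact: settled_step h h2 h3 (powR_ge0 2 q) J0 (weight_ge0 v).
Qed.

Definition all_stopped := [set w | anchor w = w].

Definition stopped_sum x : \bar R :=
  (\esum_(w in all_stopped) (weight w * \1_(set_of_cube (cube_at Q w)) x)%:E)%E.

Lemma acc_le_stopped_sum v x : set_of_cube (cube_at Q v) x -> ((acc v)%:E <= stopped_sum x)%E.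
Proof.
move=> vx; apply: esum_ge; exists [set` anchors v].
  by split; [exact: finite_seq|move=> w /anchorsP[]].
rewrite -fsbig_seq ?anchors_uniq// /acc -sumEFin le_eqVlt; apply/orP; left; apply/eqP.
apply: eq_big_seq => w /anchorsP[_ [u vE]].
rewrite indicE mem_set ?mulr1//; move: vx; rewrite vE; exact: cube_at_cat_sub.
Qed.

Lemma settled_or_unbounded x : set_of_cube Q x ->
  (exists v, [/\ anchor v = v, set_of_cube (cube_at Q v) x &
    forall u, set_of_cube (cube_at Q (u ++ v)) x -> anchor (u ++ v) = v]) \/
  (forall k, exists2 w, stopped k w & set_of_cube (cube_at Q w) x).
Proof.
move=> Qx; have [|nset] := pselect (exists v, [/\ anchor v = v, set_of_cube (cube_at Q v) x &
    forall u, set_of_cube (cube_at Q (u ++ v)) x -> anchor (u ++ v) = v]); first by left.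
right; elim=> [|k [v [av gv] vx]]; first by exists [::].
have [u [ux ua]] : exists u, set_of_cube (cube_at Q (u ++ v)) x /\ anchor (u ++ v) <> v.
  apply: contrapT => H; apply: nset; exists v; split => // u ux.
  by apply: contrapT => ua; apply: H; exists u.
(* Letters are removed until the first stop below v is found; it has generation k+1. *)
elim: u ux ua => [|e u IH] ux ua; first by case: ua.
have [au|] := pselect (anchor (u ++ v) = v); last by apply: IH; exact: (child_sub ux).
have st : stops e (u ++ v).
  by move: ua; rewrite cat_cons anchor_cons; case: ifP.
exists (e :: u ++ v) => //; split; first by rewrite anchor_cons st.
by rewrite /= st -gv -[gen (u ++ v)]gen_anchor au.
Qed.

Lemma unbounded_negligible :
  mu.-negligible [set x | forall k, exists2 w, stopped k w & set_of_cube (cube_at Q w) x].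
Proof.
pose U k := \bigcup_(w in stopped k) set_of_cube (cube_at Q w).
have mU k : measurable (U k).
  by apply: bigcup_countType_measurable => w _; exact: measurable_set_of_cube.
have mZ : measurable (\bigcap_k U k) by exact: bigcapT_measurable.
exists (\bigcap_k U k); split => //; last first.
  by move=> x H k _; have [w kw wx] := H k; exists w.
have V0 := cube_vol_gt0 Q.
have Zk k : (mu (\bigcap_k U k) <= (cube_vol Q / 2 ^+ k)%:E)%E.
  apply: (@le_trans _ _ (mu (U k))).
    by apply: le_measure; rewrite ?inE// => x; apply.
  apply: (le_trans (measure_bigcup_le_esum mu (P := stopped k)
    (fun w _ => measurable_set_of_cube (cube_at Q w)))).
  apply: le_trans (esum_stopped_vol s c0 fi k); apply: le_esum => w _.
  by rewrite [X in (X <= _)%E](lebesgue_n_cube_vol _).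
have Zfin : mu (\bigcap_k U k) \is a fin_num.
  by rewrite ge0_fin_numE// (le_lt_trans (Zk 0%N))// ltry.
apply/eqP; rewrite eq_le measure_ge0 andbT -(fineK Zfin) lee_fin leNgt; apply/negP => m0.
pose N := Num.Def.archi_bound (cube_vol Q / fine (mu (\bigcap_k U k))).
have := Zk N; rewrite -(fineK Zfin) lee_fin; apply/negP; rewrite -ltNge.
rewrite ltr_pdivrMr ?exprn_gt0// mulrC -ltr_pdivrMr//.
have := @archi_boundP R (cube_vol Q / fine (mu (\bigcap_k U k))).
move=> /(_ (divr_ge0 (ltW V0) (ltW m0)))/lt_trans; apply.
by rewrite -natrX ltr_nat ltn_expl.
Qed.

Lemma resid_le_stopped_sum_ae : {ae mu, forall x, set_of_cube Q x ->
  ((resid [::] x `^ q)%:E <= (jump_const + 2 `^ q)%:E * stopped_sum x)%E}.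
Proof.
(* The exceptional set of the differentiation theorem in the cube of v, for |f - P_v| at the level 2
   [osc v]; there are countably many words v. *)
pose Nv v := [set x | [/\ set_of_cube (cube_at Q v) x, 2 * osc v < resid v x &
    forall u, set_of_cube (cube_at (cube_at Q v) u) x ->
    (\int[mu]_(y in set_of_cube (cube_at (cube_at Q v) u)) (resid v y)%:E <=
      (2 * osc v * cube_vol (cube_at (cube_at Q v) u))%:E)%E]].
have nN : mu.-negligible (\bigcup_(v in [set: word]) Nv v).
  apply: negligible_bigcup_countType => v _; apply: dyadic_differentiation.
  - by apply/measurable_EFinP; exact: measurable_int _ (resid_integrable s c0 fi v v).
  - by move=> x _; exact: resid_ge0.
  - by rewrite mulr_ge0 ?osc_ge0.
apply: negligibleS (negligibleU nN unbounded_negligible) => x /= /not_implyP[Qx H].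
have [[v [av vx su]]|ub] := settled_or_unbounded Qx; last by right.
left; exists v => //; apply: contrapT => nNv; apply: H.
have rv : resid v x <= 2 * osc v.
  (* Below the last stop v all cubes around x have anchor v, so all dyadic means of |f - P_v| there
     are at most 2 [osc v]. *)
  rewrite leNgt; apply/negP => rv; apply: nNv; split => // u ux.
  rewrite -cube_at_cat in ux *; rewrite integral_resid// lee_fin mulrC.
  rewrite ler_wpM2r ?(ltW (cube_vol_gt0 _))//.
  by rewrite -{1 3}(su u ux) mean_resid_anchor.
apply: (@le_trans _ _ ((jump_const + 2 `^ q) * acc v)%:E).
  by rewrite lee_fin; exact: resid_settled.
rewrite EFinM; apply: lee_wpmul2l; last exact: acc_le_stopped_sum.
by rewrite lee_fin addr_ge0 ?powR_ge0// mulr_ge0 ?powR_ge0// ltW.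
Qed.

Lemma integral_resid_powR_le :
  (\int[mu]_(x in set_of_cube Q) (resid [::] x `^ q)%:E <= (jump_const + 2 `^ q)%:E *
    (\esum_(w in all_stopped) (weight w * cube_vol (cube_at Q w))%:E))%E.
Proof.
have mQ := measurable_set_of_cube Q.
have mr : measurable_fun (set_of_cube Q) (resid [::]).
  by apply/measurable_EFinP; exact: (measurable_int _ (resid_integrable s c0 fi [::] [::])).
have J0 : 0 <= jump_const + 2 `^ q.
  by rewrite addr_ge0 ?powR_ge0// mulr_ge0 ?powR_ge0// ltW.
pose h w x := (weight w * \1_(set_of_cube (cube_at Q w)) x)%:E.
have h0 w x : (0 <= h w x)%E by rewrite lee_fin mulr_ge0 ?weight_ge0.
have mh w : measurable_fun (set_of_cube Q) (h w).
  apply/measurable_EFinP; apply: measurable_funM => //.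
  by apply: measurable_indic; exact: measurable_set_of_cube.
have mS : measurable_fun (set_of_cube Q) stopped_sum.
  apply: measurable_fun_esum; [exact: mQ|by move=> w _; exact: mh|by move=> w x _ _; exact: h0].
have S0 x : (0 <= stopped_sum x)%E by apply: esum_ge0 => w _; exact: h0.
apply: (@le_trans _ _ (\int[mu]_(x in set_of_cube Q) ((jump_const + 2 `^ q)%:E * stopped_sum x))%E).
  apply: ae_ge0_le_integral => //.
  - by move=> x _; rewrite lee_fin powR_ge0.
  - apply/measurable_EFinP; apply: (measurableT_comp (measurable_powR q)) => //.
  - by move=> x _; rewrite mule_ge0.
  - exact: measurable_funeM.
  - exact: resid_le_stopped_sum_ae.
rewrite ge0_integralZl//; apply: lee_wpmul2l => //.
rewrite /stopped_sum integral_esum; [|exact: mQ|by move=> w _; exact: mh|by move=> w x _ _; exact: h0].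
apply: le_esum => w _; under eq_integral do rewrite EFinM.
rewrite ge0_integralZl//.
- rewrite integral_indic//; last exact: measurable_set_of_cube.
  rewrite setIidl; last exact: cube_at_sub.
  by rewrite [X in (_ * X <= _)%E](lebesgue_n_cube_vol _) EFinM.
- apply/measurable_EFinP; apply: measurable_indic.
  exact: measurable_set_of_cube.
- by rewrite lee_fin weight_ge0.
Qed.

Lemma all_stoppedE : all_stopped = \bigcup_k stopped k.
Proof.
apply/seteqP; split => [w aw|w [k _ [aw _]]//].
by exists (gen w).
Qed.

Variables (p K : R).
Hypotheses (p0 : 0 < p) (qp : q < p) (K0 : 0 < K).
Hypothesis stopped_le : forall k, (\esum_(w in stopped k)
  (cube_vol (cube_at Q w) * osc w `^ p)%:E <= (K `^ p)%:E)%E.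

(* osc^q <= M^(q-p) osc^p + M^q for every M > 0, and M is chosen so that the two
   resulting sums over the k-th generation are equal. *)
Lemma esum_weight_le k :
  (\esum_(w in stopped k) (weight w * cube_vol (cube_at Q w))%:E <=
   (tau ^+ k * (2 * (K `^ q * (cube_vol Q / 2 ^+ k) `^ (1 - q / p))))%:E)%E.
Proof.
have t0 := tau_gt0; have V0 := cube_vol_gt0 Q.
set W := cube_vol Q / 2 ^+ k; have W0 : 0 < W by rewrite divr_gt0// exprn_gt0.
(* M solves M^p W = K^p, which makes M^(q-p) K^p equal to M^q W. *)
pose M := K * W `^ (- p^-1); have M0 : 0 < M by rewrite mulr_gt0 ?powR_gt0.
have oq o : 0 <= o -> o `^ q <= M `^ (q - p) * o `^ p + M `^ q.
  move=> o0; have [oM|Mo] := leP o M.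
    apply: (@le_trans _ _ (M `^ q)); last by rewrite lerDr mulr_ge0 ?powR_ge0.
    by apply: ge0_ler_powR; rewrite ?nnegrE ?(ltW q0) ?(ltW M0).
  have op : 0 < o by exact: lt_trans Mo.
  apply: (@le_trans _ _ (M `^ (q - p) * o `^ p)); last by rewrite lerDl powR_ge0.
  have -> : o `^ q = o `^ (q - p) * o `^ p.
    by rewrite -powRD ?subrK// (gt_eqF op) implybT.
  apply: ler_wpM2r; first exact: powR_ge0.
  rewrite -opprB !powRN lef_pV2 ?posrE ?powR_gt0//.
  by apply: ge0_ler_powR; rewrite ?nnegrE ?subr_ge0 ?(ltW M0) ?(ltW op) ?(ltW qp) ?(ltW Mo).
have T0 : 0 <= tau ^+ k by rewrite exprn_ge0// ltW.
apply: (@le_trans _ _ (\esum_(w in stopped k)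
    ((tau ^+ k * M `^ (q - p))%:E * (cube_vol (cube_at Q w) * osc w `^ p)%:E +
     (tau ^+ k * M `^ q)%:E * (cube_vol (cube_at Q w))%:E))%E).
  apply: le_esum => w [_ gw]; rewrite -!EFinM -EFinD lee_fin /weight gw.
  have := ler_wpM2l T0 (oq (osc w) (osc_ge0 _ _ _ _ _)).
  move=> /(ler_wpM2r (ltW (cube_vol_gt0 (cube_at Q w)))) /le_trans; apply.
  by rewrite le_eqVlt; apply/orP; left; apply/eqP; ring.
rewrite esumD; last 2 first.
- by move=> w _; rewrite -EFinM lee_fin !mulr_ge0 ?powR_ge0// ltW// cube_vol_gt0.
- by move=> w _; rewrite -EFinM lee_fin !mulr_ge0 ?powR_ge0// ltW// cube_vol_gt0.
rewrite !esumZl ?mulr_ge0 ?powR_ge0//; last 2 first.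
- by move=> w _; rewrite lee_fin ltW// cube_vol_gt0.
- by move=> w _; rewrite lee_fin mulr_ge0 ?powR_ge0// ltW// cube_vol_gt0.
apply: (@le_trans _ _ ((tau ^+ k * M `^ (q - p))%:E * (K `^ p)%:E +
    (tau ^+ k * M `^ q)%:E * W%:E)%E).
  apply: leeD; apply: lee_wpmul2l; rewrite ?lee_fin ?mulr_ge0 ?powR_ge0//.
  exact: esum_stopped_vol.
rewrite -!EFinM -EFinD lee_fin.
have Wne (a b : R) : (a + b == 0) ==> (W != 0) by rewrite (gt_eqF W0) implybT.
have Kne (a b : R) : (a + b == 0) ==> (K != 0) by rewrite (gt_eqF K0) implybT.
have e1 : M `^ (q - p) * K `^ p = K `^ q * W `^ (1 - q / p).
  rewrite powRM ?powR_ge0 ?(ltW K0)// -powRrM.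
  have -> : - p^-1 * (q - p) = 1 - q / p.
    by rewrite mulrBr !mulNr mulVf ?gt_eqF// opprK mulrC addrC.
  by rewrite mulrAC -(powRD (Kne _ _)) subrK.
have e2 : M `^ q * W = K `^ q * W `^ (1 - q / p).
  rewrite powRM ?powR_ge0 ?(ltW K0)// -powRrM -mulrA; congr (_ * _).
  rewrite -{2}(powRr1 (ltW W0)) -(powRD (Wne _ _)); congr (_ `^ _).
  by rewrite mulNr mulrC addrC.
rewrite -!mulrA e1 e2 le_eqVlt; apply/orP; left; apply/eqP; ring.
Qed.

End stopping_bound.

(** * Comparison of the terms of the norms *)

Lemma esum_geometric_le {R : realType} (A r : R) : 0 <= A -> 0 < r -> r < 1 ->
  (\esum_(k in [set: nat]) (A * r ^+ k)%:E <= (A / (1 - r))%:E)%E.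
Proof.
move=> A0 r0 r1; have t0 k : (0 <= (A * r ^+ k)%:E)%E.
  by rewrite lee_fin mulr_ge0// exprn_ge0// ltW.
rewrite -nneseries_esumT//; apply: lime_le; first exact: is_cvg_nneseries.
apply: nearW => N; rewrite sumEFin lee_fin.
by apply: geometric_le_lim => //; rewrite ger0_norm// ltW.
Qed.

Section main_estimates.
Context {R : realType} {n : nat}.
Local Notation mu := (@lebesgue_n R n).
Implicit Types (Q : cube R n) (X : domain R n) (f : euclid R n -> R).

Lemma oscillation_ge0 r s c0 f Q : (0 <= oscillation r s c0 f Q)%E.
Proof. exact: poweR_ge0. Qed.

Lemma integral_resid_le_families (p q : R) (s : nat) : 1 <= q -> q < p ->
  exists2 C : R, 0 < C & forall c0 f Q K, cube_integrable Q f -> 0 < K ->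
  (forall D Qs, admissible (CubeDomain Q) D Qs ->
    (\esum_(j in D) ((cube_vol (Qs j))%:E * oscillation 1 s c0 f (Qs j) `^ p)
      <= (K `^ p)%:E)%E) ->
  (\int[mu]_(x in set_of_cube Q)
     (`|f x - poly_eval (cube_poly_loc s c0 Q f) x| `^ q)%:E <=
   (C * (K `^ q * cube_vol Q `^ (1 - q / p)))%:E)%E.
Proof.
move=> q1 qp; have q0 : 0 < q by exact: lt_le_trans q1.
have p0 : 0 < p by exact: lt_trans qp.
pose b := 1 - q / p.
have b0 : 0 < b by rewrite subr_gt0 ltr_pdivrMr// mul1r.
have b20 : 0 < b / 2 by rewrite divr_gt0.
(* Generation k contributes tau^k 2^(-bk) up to constants; this tau spends half of the decay and
   leaves the ratio r = 2^(-b/2). *)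
pose tau : R := 2 `^ (b / 2).
have tau1 : 1 < tau.
  have : 1 `^ (b / 2) < 2 `^ (b / 2) :> R.
    by apply: gt0_ltr_powR; rewrite ?nnegrE// ltr1n.
  by rewrite powR1.
have tau0 : 0 < tau by exact: lt_trans tau1.
pose r : R := tau^-1.
have r0 : 0 < r by rewrite invr_gt0.
have r1 : r < 1 by rewrite invf_lt1.
have taur : tau * (2^-1) `^ b = r.
  rewrite -[2^-1]powR_inv1// -powRrM mulN1r /r /tau -powRN -powRD ?pnatr_eq0 ?implybT//.
  by congr (_ `^ _); lra.
have [Cq Cq0 Cqle] := powRD_le q0 tau1.
pose J := @jump_const R n s q Cq + 2 `^ q.
have J0 : 0 < J.
  by rewrite ltr_wpDl ?powR_gt0// mulr_ge0 ?powR_ge0// ltW.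
exists (J * (2 / (1 - r))); first by rewrite mulr_gt0// divr_gt0// subr_gt0.
move=> c0 f Q K fi K0 famK.
have V0 := cube_vol_gt0 Q.
have := integral_resid_powR_le s c0 fi q0 tau1 Cq0 Cqle.
move=> /le_trans; apply; rewrite -/J -mulrA EFinM.
apply: lee_wpmul2l; first by rewrite lee_fin ltW.
have w0 w : (0 <= (weight s c0 f Q q tau w * cube_vol (cube_at Q w))%:E)%E.
  by rewrite lee_fin mulr_ge0 ?weight_ge0// ltW// cube_vol_gt0.
rewrite all_stoppedE esum_bigcup_esum//; last first.
  by move=> k l _ _ [w [[_ <-] [_ <-]]].
have stK k : (\esum_(w in stopped s c0 f Q k)
    (cube_vol (cube_at Q w) * osc s c0 f Q w `^ p)%:E <= (K `^ p)%:E)%E.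
  pose F Q' := ((cube_vol Q')%:E * oscillation 1 s c0 f Q' `^ p)%E.
  have [||Q'|D [Qs [adm DQ]]] := @admissible_countType R n _ (stopped s c0 f Q k)
      (cube_at Q) F (CubeDomain Q) Q.
  - by move=> w _; exact: cube_at_sub.
  - move=> w w' kw kw' [x [/euclid_interior_sub xw /euclid_interior_sub xw']].
    by apply: (@stopped_disjoint R n s c0 f Q fi k w w' kw kw'); exists x.
  - by rewrite /F mule_ge0 ?poweR_ge0// lee_fin ltW// cube_vol_gt0.
  rewrite (eq_esum (b := fun w => F (cube_at Q w))); first by rewrite DQ; exact: famK.
  by move=> w _; rewrite /F oscillation_cube_at// poweR_EFin EFinM.
pose A := 2 * (K `^ q * cube_vol Q `^ b).
have A0 : 0 <= A by rewrite !mulr_ge0 ?powR_ge0.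
apply: (@le_trans _ _ (\esum_(k in [set: nat]) (A * r ^+ k)%:E)%E).
  apply: le_esum => k _; apply: (le_trans (esum_weight_le fi q0 tau1 p0 qp K0 stK k)).
  rewrite lee_fin -/b powRM ?(ltW V0) ?invr_ge0 ?exprn_ge0//.
  have -> : (2 ^+ k)^-1 `^ b = (2^-1 `^ b) ^+ k :> R.
    rewrite -exprVn -(powR_mulrn k (_ : 0 <= 2^-1))// -powRrM mulrC powRrM.
    by rewrite powR_mulrn ?powR_ge0.
  rewrite -taur exprMn /A le_eqVlt; apply/orP; left.
  by apply/eqP; ring.
apply: le_trans (esum_geometric_le A0 r0 r1) _.
rewrite lee_fin -/b /A le_eqVlt; apply/orP; left; apply/eqP; ring.
Qed.

Definition jn_term (p r : R) s c0 alpha f Q : \bar R :=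
  ((cube_vol Q)%:E * ((cube_vol Q `^ (- alpha))%R%:E * oscillation r s c0 f Q) `^ p)%E.

Lemma jn_term_ge0 p r s c0 alpha f Q : (0 <= jn_term p r s c0 alpha f Q)%E.
Proof. by rewrite mule_ge0 ?poweR_ge0// lee_fin ltW// cube_vol_gt0. Qed.

Lemma jn_termE p r s c0 alpha f Q : 0 < p -> jn_term p r s c0 alpha f Q =
  ((cube_vol Q `^ (- (alpha * p)))%:E *
   ((cube_vol Q)%:E * oscillation r s c0 f Q `^ p))%E.
Proof.
move=> p0; rewrite /jn_term poweRM ?lee_fin ?powR_ge0 ?oscillation_ge0//.
by rewrite poweR_EFin -powRrM mulNr muleCA.
Qed.

Lemma cube_vol_le Q Q' : set_of_cube Q' `<=` set_of_cube Q -> cube_vol Q' <= cube_vol Q.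
Proof.
move=> QQ; rewrite -lee_fin -!lebesgue_n_cube_vol; apply: le_measure => //;
  rewrite inE; exact: measurable_set_of_cube.
Qed.

(** For Q' in Q, alpha >= 0 gives |Q'|^(-alpha p) >= |Q|^(-alpha p), so the sums without alpha are
    bounded by K^p = |Q|^(alpha p) T. *)
Lemma integral_resid_le_terms (p q : R) (s : nat) (alpha : R) : 1 <= q -> q < p -> 0 <= alpha ->
  exists2 C : R, 0 < C & forall c0 f Q T, cube_integrable Q f -> 0 < T ->
  (forall D Qs, admissible (CubeDomain Q) D Qs ->
    (\esum_(j in D) jn_term p 1 s c0 alpha f (Qs j) <= T%:E)%E) ->
  (\int[mu]_(x in set_of_cube Q)
     (`|f x - poly_eval (cube_poly_loc s c0 Q f) x| `^ q)%:E <=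
   (C * ((cube_vol Q `^ (alpha * p) * T) `^ (q / p) * cube_vol Q `^ (1 - q / p)))%:E)%E.
Proof.
move=> q1 qp al0; have q0 : 0 < q by exact: lt_le_trans q1.
have p0 : 0 < p by exact: lt_trans qp.
have [C C0 H] := integral_resid_le_families s q1 qp; exists C => // c0 f Q T fi T0 famT.
have V0 := cube_vol_gt0 Q.
pose K := (cube_vol Q `^ (alpha * p) * T) `^ p^-1.
have VT0 : 0 < cube_vol Q `^ (alpha * p) * T by rewrite mulr_gt0 ?powR_gt0.
have K0 : 0 < K by rewrite powR_gt0.
have Kp : K `^ p = cube_vol Q `^ (alpha * p) * T.
  by rewrite /K -powRrM mulVf ?gt_eqF// powRr1// ltW.
have Kq : K `^ q = (cube_vol Q `^ (alpha * p) * T) `^ (q / p).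
  by rewrite /K -powRrM (mulrC p^-1).
rewrite -Kq; apply: H => // D Qs adm; rewrite Kp.
have ap0 : 0 <= alpha * p by rewrite mulr_ge0// ltW.
apply: (@le_trans _ _ (\esum_(j in D) ((cube_vol Q `^ (alpha * p))%:E * jn_term p 1 s c0 alpha f (Qs j)))%E).
  apply: le_esum => j Dj; have Vj0 := cube_vol_gt0 (Qs j).
  have Vj := cube_vol_le (adm.1 j Dj).
  rewrite jn_termE// muleA -EFinM -[X in (X <= _)%E]mul1e; apply: lee_wpmul2r.
    by rewrite mule_ge0 ?poweR_ge0// lee_fin ltW.
  rewrite lee_fin powRN ler_pdivlMr ?powR_gt0// mul1r.
  by apply: ge0_ler_powR; rewrite ?nnegrE ?(ltW V0) ?(ltW Vj0).
rewrite esumZl ?powR_ge0// => [|j _]; last exact: jn_term_ge0.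
by rewrite EFinM; apply: lee_wpmul2l; [rewrite lee_fin powR_ge0|exact: famT].
Qed.

Lemma jn_term_le (p q : R) (s : nat) (alpha : R) : 1 <= q -> q < p -> 0 <= alpha ->
  exists2 C : R, 0 < C & forall c0 f Q T, cube_integrable Q f -> 0 < T ->
  (forall D Qs, admissible (CubeDomain Q) D Qs ->
    (\esum_(j in D) jn_term p 1 s c0 alpha f (Qs j) <= T%:E)%E) ->
  (jn_term p q s c0 alpha f Q <= (C * T)%:E)%E.
Proof.
move=> q1 qp al0; have q0 : 0 < q by exact: lt_le_trans q1.
have p0 : 0 < p by exact: lt_trans qp.
have [C C0 H] := integral_resid_le_terms s q1 qp al0.
exists (C `^ (p / q)); first exact: powR_gt0.
move=> c0 f Q T fi T0 famT; have := H c0 f Q T fi T0 famT.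
have V0 := cube_vol_gt0 Q; set V := cube_vol Q in V0 *.
rewrite jn_termE// /oscillation /cube_mean -/V.
set I := integral _ _ _.
have I0 : (0 <= I)%E by apply: integral_ge0 => x _; rewrite lee_fin powR_ge0.
case: I I0 => [i||]//.
move=> i0; rewrite lee_fin => hi; rewrite lee_fin in i0.
have -> : ((V^-1)%:E * i%:E = (V^-1 * i)%:E)%E by [].
rewrite !poweR_EFin -!EFinM lee_fin -powRrM.
have Vi0 : 0 <= V^-1 by rewrite invr_ge0 ltW.
have pq0 : 0 <= q^-1 * p by rewrite mulr_ge0 ?invr_ge0// ltW.
set c := C * _ in hi; have c0' : 0 <= c by exact: le_trans hi.
apply: (@le_trans _ _ (V `^ (- (alpha * p)) * (V * (V^-1 * c) `^ (q^-1 * p)))).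
  apply: ler_wpM2l; first exact: powR_ge0.
  apply: ler_wpM2l; first exact: ltW.
  apply: (ge0_ler_powR pq0); rewrite ?nnegrE; [exact: mulr_ge0|exact: mulr_ge0|].
  exact: ler_wpM2l.
have E0 : 0 <= V `^ (alpha * p) * T by rewrite mulr_ge0 ?powR_ge0// ltW.
(* The exponents are homogeneous: after the power p / q, all powers of the volume cancel against the
   prefactors of the term. *)
have -> : (V^-1 * c) `^ (q^-1 * p) = C `^ (p / q) * (V `^ (alpha * p) * T) * V^-1.
  have Vne (a b : R) : (a + b == 0) ==> (V != 0) by rewrite (gt_eqF V0) implybT.
  have -> : V^-1 * c = C * (V `^ (alpha * p) * T) `^ (q / p) * V `^ (- (q / p)).
    rewrite /c -(powR_inv1 (ltW V0)) mulrC -!mulrA; congr (_ * (_ * _)).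
    by rewrite -(powRD (Vne _ _)); congr (_ `^ _); ring.
  rewrite powRM ?mulr_ge0 ?powR_ge0 ?(ltW C0)// powRM ?powR_ge0 ?(ltW C0)//.
  rewrite -!powRrM [q^-1 * p]mulrC.
  have -> : q / p * (p / q) = 1 by rewrite mulrA divfK ?gt_eqF// divff ?gt_eqF.
  rewrite powRr1// mulNr.
  have -> : q / p * (p / q) = 1 by rewrite mulrA divfK ?gt_eqF// divff ?gt_eqF.
  by rewrite powR_inv1// ltW.
rewrite powRN le_eqVlt; apply/orP; left; apply/eqP.
have Ene : V `^ (alpha * p) != 0 by rewrite gt_eqF// powR_gt0.
have Vn : V != 0 by rewrite gt_eqF.
by field; rewrite Ene Vn.
Qed.

End main_estimates.

(** * The spaces *)

Section jn_spaces.
Context {R : realType} {n : nat}.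
Local Notation mu := (@lebesgue_n R n).
Implicit Types (Q : cube R n) (X : domain R n) (f : euclid R n -> R) (E : set (euclid R n)).

Lemma cube_bounded Q : euclid_bounded (set_of_cube Q).
Proof.
exists (\sum_(j < n) `|corner Q j| + side Q) => x Qx i.
apply: (le_trans (cube_coord_le i Qx)); rewrite lerD2r (bigD1 i)//= lerDl.
by apply: sumr_ge0.
Qed.

Lemma bounded_sub_cube X E : euclid_bounded E -> E `<=` set_of_domain X ->
  exists Q, E `<=` set_of_cube Q /\ set_of_cube Q `<=` set_of_domain X.
Proof.
case: X => [|Q0] [M EM] EX; last by exists Q0; split.
have M0 : 0 < 2 * (`|M| + 1) :> R by rewrite mulr_gt0// ltr_wpDl.
exists (Cube (fun=> - (`|M| + 1)) M0 (fun=> true) (fun=> true)); split => // x Ex i.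
have := EM x Ex i; have := ler_norm M; rewrite ler_norml /edge/= in_itv/=.
by move=> h /andP[h1 h2]; apply/andP; split; lra.
Qed.

Lemma measurable_set_of_domain X : measurable (set_of_domain X).
Proof. by case: X => [|Q]; [exact: measurableT|exact: measurable_set_of_cube]. Qed.

Lemma Lfun_restrictP (q : R) f E : 0 < q -> measurable E ->
  f \_ E \in Lfun mu q%:E <->
  measurable_fun E f /\ (\int[mu]_(x in E) (`|f x| `^ q)%:E < +oo)%E.
Proof.
move=> q0 mE.
have IE : (\int[mu]_x (`|(EFin \o f \_ E) x| `^ q) = \int[mu]_(x in E) (`|f x| `^ q)%:E)%E.
  rewrite [RHS]integral_mkcond; apply: eq_integral => x _; rewrite /= !patchE.
  by case: ifP => _; rewrite ?normr0 ?powR0 ?gt_eqF.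
have NE : ('N[mu]_q%:E[EFin \o f \_ E] < +oo <-> \int[mu]_(x in E) (`|f x| `^ q)%:E < +oo)%E.
  rewrite -IE -poweR_Lnorm ?gt_eqF//; split; first exact: poweR_lty.
  by apply: lty_poweRy; rewrite gt_eqF.
split=> [/andP[/set_mem/= mf /set_mem/= fin]|[mf fin]].
  split; first exact: (measurable_restrictT _ mE).2 mf.
  exact: NE.1 fin.
apply/andP; split; apply/mem_set => /=; first exact: (measurable_restrictT _ mE).1 mf.
exact: NE.2 fin.
Qed.

Lemma Lq_loc_cube_integrable X f Q : Lq_loc X 1 f -> set_of_cube Q `<=` set_of_domain X ->
  cube_integrable Q f.
Proof.
move=> [_ locf] QX; have mQ := measurable_set_of_cube Q.
have := locf _ mQ (cube_bounded Q) QX => /(Lfun_restrictP _ ltr01 mQ)[mf fin].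
apply/integrableP; split; first exact/measurable_EFinP.
apply: le_lt_trans fin; rewrite le_eqVlt; apply/orP; left; apply/eqP.
by apply: eq_integral => x _; rewrite powRr1.
Qed.

Lemma mu_bounded_lty E : measurable E -> euclid_bounded E -> (mu E < +oo)%E.
Proof.
move=> mE bE; have [Q [EQ _]] := @bounded_sub_cube WholeSpace E bE (@subsetT _ _).
apply: (@le_lt_trans _ _ (mu (set_of_cube Q))); last by rewrite lebesgue_n_cube ltry.
by apply: le_measure; rewrite ?inE//; exact: measurable_set_of_cube.
Qed.

(** Pointwise substitute for the Jensen inequality, integrated in [oscillation1_le] with lam near
    the L^q mean; it costs the factor 2 there. *)
Lemma le_split_powR (q lam g : R) : 1 <= q -> 0 < lam -> 0 <= g ->
  g <= lam + lam `^ (1 - q) * g `^ q.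
Proof.
move=> q1 l0 g0; have [gl|lg] := leP g lam.
  by rewrite (le_trans gl)// lerDl mulr_ge0 ?powR_ge0.
have gp : 0 < g by exact: lt_trans lg.
apply: (@le_trans _ _ (lam `^ (1 - q) * g `^ q)); last by rewrite lerDr ltW.
rewrite -{1}(powRr1 g0) -{1}(subrK q 1) powRD ?(gt_eqF gp) ?implybT//.
apply: ler_wpM2r; first exact: powR_ge0.
rewrite -opprB !powRN lef_pV2 ?posrE ?powR_gt0//.
by apply: ge0_ler_powR; rewrite ?nnegrE ?subr_ge0 ?(ltW l0) ?(ltW lg).
Qed.

Lemma oscillation1_le (q : R) s c0 f Q : 1 <= q -> cube_integrable Q f ->
  (oscillation 1 s c0 f Q <= 2%:E * oscillation q s c0 f Q)%E.
Proof.
move=> q1 fi; have q0 : 0 < q by exact: lt_le_trans q1.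
have V0 := cube_vol_gt0 Q; have mQ := measurable_set_of_cube Q.
rewrite oscillation1E// /oscillation /cube_mean.
pose g x := `|f x - poly_eval (cube_poly_loc s c0 Q f) x|.
have ri := cube_integrableB fi (cube_integrable_poly Q (cube_poly_loc s c0 Q f)).
have gi : cube_integrable Q g by exact: (integrable_norm ri).
have mg : measurable_fun (set_of_cube Q) g.
  by apply/measurable_EFinP; exact: (measurable_int _ gi).
have mgq : measurable_fun (set_of_cube Q) (fun x => (g x `^ q)%:E).
  by apply/measurable_EFinP; exact: (measurableT_comp (measurable_powR q)).
have g0 x : 0 <= g x by exact: normr_ge0.
have : (0 <= \int[mu]_(x in set_of_cube Q) (g x `^ q)%:E)%E.
  by apply: integral_ge0 => x _; rewrite lee_fin powR_ge0.
(* f is integrable but |f - P|^q need not be; if its integral is infinite, so is the right-hand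
   side. *)
rewrite -/g; case Iq : (\int[mu]_(x in set_of_cube Q) (g x `^ q)%:E)%E => [i||]// i0; last first.
  rewrite gt0_muley ?lte_fin ?invr_gt0// poweRyr ?invr_eq0 ?gt_eqF//.
  by rewrite gt0_muley ?leey// lte_fin.
rewrite lee_fin in i0.
have -> : ((cube_vol Q)^-1%:E * i%:E = ((cube_vol Q)^-1 * i)%:E)%E by [].
rewrite poweR_EFin -EFinM lee_fin; set m := (_^-1 * i).
have m0 : 0 <= m by rewrite mulr_ge0// invr_ge0 ltW.
apply/ler_addgt0Pr => e e0.
(* The added e / 2 keeps lam positive when the L^q mean is 0. *)
pose lam := m `^ q^-1 + e / 2.
have e2 : 0 < e / 2 by rewrite divr_gt0.
have l0 : 0 < lam by rewrite ltr_wpDl// powR_ge0.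
have ml : m <= lam `^ q.
  have -> : m = (m `^ q^-1) `^ q by rewrite -powRrM mulVf ?gt_eqF// powRr1.
  apply: ge0_ler_powR; rewrite ?nnegrE ?powR_ge0 ?(ltW q0) ?(ltW l0)//.
  by rewrite lerDl ltW.
have -> : 2 * m `^ q^-1 + e = 2 * lam by rewrite /lam; lra.
rewrite mulrC ler_pdivrMr// -lee_fin.
have -> : ((\int[mu]_(x in set_of_cube Q) g x)%:E = \int[mu]_(x in set_of_cube Q) (g x)%:E)%E.
  by rewrite /Rintegral fineK; [by []|have h := integrable_fin_num mQ gi; exact: h].
apply: (@le_trans _ _ (\int[mu]_(x in set_of_cube Q)
   (cst lam%:E x + (lam `^ (1 - q))%:E * (g x `^ q)%:E))%E).
  apply: ge0_le_integral => //.
  - by move=> x _; rewrite lee_fin.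
  - exact/measurable_EFinP.
  - by apply: emeasurable_funD => //; exact: measurable_funeM.
  - by move=> x _; rewrite -EFinM -EFinD lee_fin; exact: le_split_powR.
rewrite ge0_integralD//; last 3 first.
- by move=> x _; rewrite lee_fin ltW.
- by move=> x _; rewrite -EFinM lee_fin mulr_ge0 ?powR_ge0.
- exact: measurable_funeM.
rewrite integral_cst// ge0_integralZl//; last 2 first.
- by move=> x _; rewrite lee_fin powR_ge0.
- by rewrite lee_fin powR_ge0.
rewrite Iq [X in (_ * X + _ <= _)%E](lebesgue_n_cube_vol _) -!EFinM -EFinD lee_fin.
have -> : i = m * cube_vol Q by rewrite /m mulrAC mulVf ?mul1r// gt_eqF.
rewrite mulrA -mulrDl ler_wpM2r ?(ltW V0)//.
have -> : 2 * lam = lam + lam by lra.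
rewrite lerD2l; apply: (@le_trans _ _ (lam `^ (1 - q) * lam `^ q)).
  by apply: ler_wpM2l => //; exact: powR_ge0.
by rewrite -powRD ?(gt_eqF l0) ?implybT// subrK powRr1// ltW.
Qed.

Section norms.
Variables (p : R) (s : nat) (c0 alpha : R).
Hypothesis p0 : 0 < p.
Implicit Types (D : set nat) (Qs : nat -> cube R n).
Local Notation term r := (jn_term p r s c0 alpha).

Lemma jn_norm_le r X f B : 0 <= B ->
  (forall D Qs, admissible X D Qs -> (\esum_(j in D) term r f (Qs j) <= B%:E)%E) ->
  (jn_norm X c0 p r s alpha f <= (B `^ p^-1)%:E)%E.
Proof.
move=> B0 H; apply: ge_ereal_sup => _ [D [Qs [adm ->]]].
rewrite -poweR_EFin; apply: gt0_ler_poweR; rewrite ?invr_ge0 ?(ltW p0)//.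
- rewrite in_itv/= leey andbT; apply: esum_ge0 => j _; exact: jn_term_ge0.
- by rewrite in_itv/= lee_fin B0 leey.
- exact: H.
Qed.

Lemma jn_norm_ge r X f (nu : R) : 0 <= nu -> (jn_norm X c0 p r s alpha f <= nu%:E)%E ->
  forall D Qs, admissible X D Qs -> (\esum_(j in D) term r f (Qs j) <= (nu `^ p)%:E)%E.
Proof.
move=> nu0 fnu D Qs adm; set S := esum _ _.
have S0 : (0 <= S)%E by apply: esum_ge0 => j _; exact: jn_term_ge0.
have Snu : (S `^ p^-1 <= nu%:E)%E.
  by apply: le_trans fnu; apply: ereal_sup_ubound; exists D, Qs.
have pn0 : p != 0 by rewrite gt_eqF.
rewrite -(poweRe1 S0) -(mulVf pn0) poweRrM -poweR_EFin.
apply: gt0_ler_poweR; rewrite ?(ltW p0)// in_itv/= leey andbT ?poweR_ge0//.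
Qed.

Lemma admissible0 X (Q : cube R n) : admissible X set0 (fun=> Q).
Proof. by split => // j []. Qed.

Definition unit_cube : cube R n := Cube (fun=> 0) ltr01 (fun=> true) (fun=> true).

Lemma jn_norm_ge0 r X f : (0 <= jn_norm X c0 p r s alpha f)%E.
Proof.
apply: le_trans (ereal_sup_ubound _); last first.
  by exists set0, (fun=> unit_cube); split; first exact: admissible0.
exact: poweR_ge0.
Qed.

Lemma admissibleS X D Qs (Q : cube R n) : set_of_cube Q `<=` set_of_domain X ->
  admissible (CubeDomain Q) D Qs -> admissible X D Qs.
Proof. by move=> QX [h1 h2]; split => // j Dj x /(h1 j Dj)/QX. Qed.

Lemma jn_term1_le q f Q : 1 <= q -> cube_integrable Q f ->
  (term 1 f Q <= (2 `^ p)%:E * term q f Q)%E.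
Proof.
move=> q1 fi; rewrite !jn_termE// [leRHS]muleCA; apply: lee_wpmul2l.
  by rewrite lee_fin powR_ge0.
rewrite muleCA; apply: lee_wpmul2l; first by rewrite lee_fin ltW// cube_vol_gt0.
rewrite -poweR_EFin -poweRM ?lee_fin ?oscillation_ge0//.
apply: gt0_ler_poweR; rewrite ?(ltW p0)// ?in_itv/= ?leey ?andbT ?oscillation_ge0//.
- by rewrite mule_ge0 ?lee_fin ?oscillation_ge0.
- exact: oscillation1_le.
Qed.

Lemma jn_norm1_le q X f (nu : R) : 1 <= q -> Lq_loc X 1 f -> 0 <= nu ->
  (jn_norm X c0 p q s alpha f <= nu%:E)%E -> (jn_norm X c0 p 1 s alpha f <= (2 * nu)%:E)%E.
Proof.
move=> q1 locf nu0 fnu.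
have -> : 2 * nu = ((2 * nu) `^ p) `^ p^-1.
  by rewrite -powRrM divff ?gt_eqF// powRr1// mulr_ge0.
apply: jn_norm_le; first exact: powR_ge0.
move=> D Qs adm; apply: (@le_trans _ _ (\esum_(j in D) ((2 `^ p)%:E * term q f (Qs j)))%E).
  apply: le_esum => j Dj; apply: jn_term1_le => //.
  exact: Lq_loc_cube_integrable locf (adm.1 j Dj).
rewrite esumZl ?powR_ge0// => [|j _]; last exact: jn_term_ge0.
rewrite powRM// EFinM; apply: lee_wpmul2l; first by rewrite lee_fin powR_ge0.
exact: jn_norm_ge fnu _ _ adm.
Qed.

(** |f| <= 1 + |f|^q, and bounded measurable sets have finite measure. *)
Lemma Lq_loc_1 q X f : 1 <= q -> Lq_loc X q f -> Lq_loc X 1 f.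
Proof.
move=> q1 [mf locf]; have q0 : 0 < q by exact: lt_le_trans q1.
split => // E mE bE EX; apply/(Lfun_restrictP _ ltr01 mE).
have [mfE fin] := (Lfun_restrictP f q0 mE).1 (locf E mE bE EX).
split => //.
have mn : measurable_fun E (fun x => `|f x|) by exact: measurableT_comp.
have mq : measurable_fun E (fun x => (`|f x| `^ q)%:E).
  by apply/measurable_EFinP; exact: (measurableT_comp (measurable_powR q)).
apply: (@le_lt_trans _ _ (\int[mu]_(x in E) (cst 1 x + (`|f x| `^ q)%:E))%E).
  apply: ge0_le_integral => //.
  - by apply/measurable_EFinP; exact: (measurableT_comp (measurable_powR 1)).
  - exact: emeasurable_funD.
  - move=> x _; rewrite powRr1// -EFinD lee_fin.
    by have := @le_split_powR q 1 `|f x| q1 ltr01 (normr_ge0 _); rewrite powR1 mul1r.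
rewrite ge0_integralD//.
by rewrite integral_cst// mul1e lte_add_pinfty//; exact: mu_bounded_lty.
Qed.

End norms.
End jn_spaces.

(** * From the 1-norm to the q-norm *)

Section jn_equivalence.
Context {R : realType} {n : nat}.
Local Notation mu := (@lebesgue_n R n).
Implicit Types (Q : cube R n) (X : domain R n) (f : euclid R n -> R) (E : set (euclid R n)).

(** Replaces the bound over all families inside Q by one witness family, which can then be joined
    with those of other cubes. The a priori bound B serves to make the q-term finite and does not
    enter the constant. *)
Lemma jn_term_le_family (p q : R) (s : nat) (alpha : R) : 1 <= q -> q < p -> 0 <= alpha ->
  exists2 C : R, 0 < C & forall c0 f Q B, cube_integrable Q f -> 0 <= B ->
  (forall D Qs, admissible (CubeDomain Q) D Qs ->
    (\esum_(j in D) jn_term p 1 s c0 alpha f (Qs j) <= B%:E)%E) ->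
  exists DQ : set nat * (nat -> cube R n), admissible (CubeDomain Q) DQ.1 DQ.2 /\
    (jn_term p q s c0 alpha f Q <=
     C%:E * \esum_(j in DQ.1) jn_term p 1 s c0 alpha f (DQ.2 j))%E.
Proof.
move=> q1 qp al0; have [C C0 H] := @jn_term_le R n p q s alpha q1 qp al0.
exists (2 * C); first by rewrite mulr_gt0.
move=> c0 f Q B fi B0 famB.
have C20 : 0 < 2 * C by rewrite mulr_gt0.
(* B may be 0 while [H] wants a positive bound; only finiteness is used. *)
have fin : (jn_term p q s c0 alpha f Q <= (C * (B + 1))%:E)%E.
  apply: H => //; first by rewrite ltr_wpDl.
  by move=> D Qs /famB/le_trans; apply; rewrite lee_fin lerDl.
case tE : (jn_term p q s c0 alpha f Q) (jn_term_ge0 p q s c0 alpha f Q) fin => [t| |]//.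
rewrite !lee_fin => t0 _.
have [t00|tn0] := eqVneq t 0.
  exists (set0, fun=> Q); split; first exact: admissible0.
  by rewrite t00 esum_set0 mule0.
have tp : 0 < t by rewrite lt_neqAle eq_sym tn0.
apply: contrapT => nex.
(* If every family had sum at most t / (2C), the term t would be at most t / 2. *)
have T0 : 0 < t / (2 * C) by rewrite divr_gt0.
have := H c0 f Q _ fi T0; rewrite tE lee_fin => h.
suff : t <= t / 2 by lra.
have -> : t / 2 = C * (t / (2 * C)) by field; rewrite gt_eqF.
apply: h => D Qs adm; rewrite leNgt; apply/negP => lt.
apply: nex; exists (D, Qs); split => //=.
rewrite -[t](divfK (lt0r_neq0 C20)) mulrC EFinM.
by apply: lee_wpmul2l; [rewrite lee_fin ltW|exact: ltW].
Qed.

(** A bounded set lies in a single cube Q inside X. The stopping bound makes |f - P|^q integrable on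
    Q, and the polynomial P is bounded there. *)
Lemma Lq_loc_of_jn1 (p q : R) (s : nat) (alpha c0 nu : R) X f :
  1 <= q -> q < p -> 0 <= alpha -> 0 <= nu -> Lq_loc X 1 f ->
  (jn_norm X c0 p 1 s alpha f <= nu%:E)%E -> Lq_loc X q f.
Proof.
move=> q1 qp al0 nu0 locf fnu; have q0 : 0 < q by exact: lt_le_trans q1.
have p0 : 0 < p by exact: lt_trans qp.
have [C C0 H] := @integral_resid_le_terms R n p q s alpha q1 qp al0.
have [mf _] := locf; split => // E mE bE EX; apply/(Lfun_restrictP _ q0 mE).
split; first by apply: measurable_funS mf => //; exact: measurable_set_of_domain.
have [Q [EQ QX]] := bounded_sub_cube bE EX.
have fi := Lq_loc_cube_integrable locf QX.
have mQ := measurable_set_of_cube Q.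
pose P := cube_poly_loc s c0 Q f.
have T0 : 0 < nu `^ p + 1 by rewrite ltr_wpDl// powR_ge0.
have := H c0 f Q (nu `^ p + 1) fi T0; rewrite -/P.
set bound := (C * _)%:E => resid_bound.
have {}resid_bound : (\int[mu]_(x in set_of_cube Q) (`|f x - poly_eval P x| `^ q)%:E <= bound)%E.
  apply: resid_bound => D Qs adm.
  apply: (le_trans (jn_norm_ge p0 nu0 fnu (admissibleS QX adm))).
  by rewrite lee_fin lerDl.
have [B BP] := poly_eval_bounded Q P.
have [Cq Cq0 Cqle] := @powRD_le R q 2 q0 (ltr1n R 2).
have mfQ : measurable_fun (set_of_cube Q) f.
  by apply/measurable_EFinP; exact: (measurable_int _ fi).
have mP : measurable_fun (set_of_cube Q) (poly_eval P).
  by apply: measurable_funTS; exact: measurable_poly_eval.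
have mpow (h : euclid R n -> R) : measurable_fun (set_of_cube Q) h ->
    measurable_fun (set_of_cube Q) (fun x => (`|h x| `^ q)%:E).
  move=> mh; apply/measurable_EFinP; apply: (measurableT_comp (measurable_powR q)).
  exact: measurableT_comp.
have B0 : 0 <= `|B| by [].
apply: (@le_lt_trans _ _ (\int[mu]_(x in set_of_cube Q)
    (Cq%:E * (`|f x - poly_eval P x| `^ q)%:E + cst (2 * `|B| `^ q)%:E x))%E).
  apply: (@le_trans _ _ (\int[mu]_(x in set_of_cube Q) (`|f x| `^ q)%:E)%E).
    apply: ge0_subset_integral => //; first exact: mpow.
  apply: ge0_le_integral => //; first exact: mpow.
    apply: emeasurable_funD => //; apply: measurable_funeM; apply: mpow.
    exact: measurable_funB.
  move=> x Qx; rewrite -EFinM -EFinD lee_fin.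
  have tri : `|f x| <= `|f x - poly_eval P x| + `|B|.
    rewrite -{1}(subrK (poly_eval P x) (f x)); apply: (le_trans (ler_normD _ _)).
    by rewrite lerD2l (le_trans (BP x Qx))// ler_norm.
  apply: le_trans (Cqle _ _ (normr_ge0 _) B0).
  by apply: ge0_ler_powR; rewrite ?nnegrE ?(ltW q0)// addr_ge0.
have mr : measurable_fun (set_of_cube Q) (fun x => (`|f x - poly_eval P x| `^ q)%:E).
  by apply: mpow; exact: measurable_funB.
rewrite ge0_integralD//; try exact: measurable_funeM;
  try (by move=> x _; rewrite -?EFinM lee_fin mulr_ge0 ?powR_ge0// ltW).
rewrite ge0_integralZl//; last by rewrite lee_fin ltW.
rewrite integral_cst// [X in (_ + _ * X < _)%E](lebesgue_n_cube_vol _) -EFinM.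
apply: lte_add_pinfty; last exact: ltry.
apply: lte_mul_pinfty; [by rewrite lee_fin ltW|by []|].
exact: le_lt_trans resid_bound (ltry _).
Qed.

Lemma jn_norm_le_jn1 (p q : R) (s : nat) (alpha : R) : 1 <= q -> q < p -> 0 <= alpha ->
  exists2 C : R, 0 < C & forall X c0 f nu, Lq_loc X 1 f -> 0 <= nu ->
    (jn_norm X c0 p 1 s alpha f <= nu%:E)%E ->
    (jn_norm X c0 p q s alpha f <= (C * nu)%:E)%E.
Proof.
move=> q1 qp al0; have q0 : 0 < q by exact: lt_le_trans q1.
have p0 : 0 < p by exact: lt_trans qp.
have [C C0 H] := jn_term_le_family s q1 qp al0.
exists (C `^ p^-1); first exact: powR_gt0.
move=> X c0 f nu locf nu0 fnu.
have -> : C `^ p^-1 * nu = (C * nu `^ p) `^ p^-1.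
  by rewrite powRM ?powR_ge0 ?(ltW C0)// -powRrM divff ?gt_eqF// powRr1.
apply: jn_norm_le => //; first by rewrite mulr_ge0 ?powR_ge0// ltW.
move=> D Qs adm; have [subX disj] := adm.
have /choice[DQ DQP] : forall j, exists DQ : set nat * (nat -> cube R n), D j ->
    admissible (CubeDomain (Qs j)) DQ.1 DQ.2 /\
    (jn_term p q s c0 alpha f (Qs j) <=
     C%:E * \esum_(k in DQ.1) jn_term p 1 s c0 alpha f (DQ.2 k))%E.
  move=> j; have [Dj|nDj] := pselect (D j); last by exists (set0, fun=> Qs j).
  have [|||DQ DQP] := H c0 f (Qs j) (nu `^ p).
  - exact: Lq_loc_cube_integrable locf (subX j Dj).
  - exact: powR_ge0.
  - move=> D' Qs' adm'.
    exact: (jn_norm_ge p0 nu0 fnu (admissibleS (subX j Dj) adm')).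
  - by exists DQ.
pose F := jn_term p 1 s c0 alpha f.
have F0 Q : (0 <= F Q)%E by exact: jn_term_ge0.
apply: (@le_trans _ _ (\esum_(j in D) (C%:E * \esum_(k in (DQ j).1) F ((DQ j).2 k)))%E).
  by apply: le_esum => j Dj; have [] := DQP j Dj.
rewrite esumZl ?(ltW C0)// => [|j _]; last by apply: esum_ge0.
rewrite EFinM; apply: lee_wpmul2l; first by rewrite lee_fin ltW.
rewrite esum_esum//.
(* Pairs of a cube of the outer family and a cube of its witness family; the pairs are renumbered by
   nat afterwards. *)
pose W := D `*`` (fun j => (DQ j).1).
have [|||D' [Qs' [adm' ->]]] := @admissible_countType R n _ W (fun jk => (DQ jk.1).2 jk.2) F X (Qs 0%N).
- move=> [j k] [/= Dj DQk]; have [[h _] _] := DQP j Dj.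
  by move=> x /(h k DQk)/subX; apply.
- move=> [j k] [j' k'] [/= Dj DQk] [/= Dj' DQk'] [x [xk xk']].
  have [[h1 h2] _] := DQP j Dj; have [[h1' h2'] _] := DQP j' Dj'.
  (* A common interior point of two inner cubes is interior to both outer cubes, which forces these
     to agree. *)
  have jj' : j = j'.
    apply: disj => //; exists x; split.
      exact: (euclid_interiorS (h1 k DQk) xk).
    exact: (euclid_interiorS (h1' k' DQk') xk').
  rewrite -jj' in DQk' xk' *; congr pair.
  by apply: h2 => //; exists x.
- by [].
exact: (jn_norm_ge p0 nu0 fnu adm').
Qed.

End jn_equivalence.

Theorem proposition3p1 (R : realType) (n : nat) (hn : (0 < n)%N)
    (p q : R) (hp : 1 < p) (hq : 1 <= q) (hqp : q < p)
    (s : nat) (alpha : R) (halpha : 0 <= alpha)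
    (X : domain R n) (c0 : R) (hc0 : 0 < c0) (hc0X : (c0%:E < domain_side X)%E) :
  jn X c0 p q s alpha = jn X c0 p 1 s alpha /\
  exists C1 C2 : R, [/\ 0 < C1, 0 < C2 &
    forall f : euclid R n -> R, jn X c0 p q s alpha f ->
      (C1%:E * jn_norm X c0 p 1 s alpha f <= jn_norm X c0 p q s alpha f)%E /\
      (jn_norm X c0 p q s alpha f <= C2%:E * jn_norm X c0 p 1 s alpha f)%E].
Proof.
have p0 : 0 < p by exact: lt_trans hp.
have finite_norm r f : (jn_norm X c0 p r s alpha f < +oo)%E ->
    exists2 nu : R, 0 <= nu & jn_norm X c0 p r s alpha f = nu%:E.
  have := jn_norm_ge0 p s c0 alpha r X f.
  case: (jn_norm _ _ _ _ _ _ _) => [nu||]// nu0 _; exists nu => //.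
have easy f : jn X c0 p q s alpha f -> Lq_loc X 1 f /\
    (jn_norm X c0 p 1 s alpha f <= 2%:E * jn_norm X c0 p q s alpha f)%E.
  move=> [locf /finite_norm[nu nu0 fnu]]; have loc1 := Lq_loc_1 hq locf.
  split => //; rewrite fnu; apply: jn_norm1_le hq loc1 nu0 _ => //.
  by rewrite fnu.
have [C C0 H] := @jn_norm_le_jn1 R n p q s alpha hq hqp halpha.
have jnE : jn X c0 p q s alpha = jn X c0 p 1 s alpha.
  apply/seteqP; split => f fjn.
    have [loc1 le1] := easy f fjn; split => //; apply: (le_lt_trans le1).
    by have [_ /finite_norm[nu _ ->]] := fjn; rewrite -EFinM ltry.
  have [loc1 /finite_norm[nu nu0 fnu]] := fjn.
  have fnu' : (jn_norm X c0 p 1 s alpha f <= nu%:E)%E by rewrite fnu.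
  split; first exact: Lq_loc_of_jn1 hq hqp halpha nu0 loc1 fnu'.
  exact: le_lt_trans (H X c0 f nu loc1 nu0 fnu') (ltry _).
(* The constant 1/2 inverts the factor 2 of [oscillation1_le]. *)
split => //; exists 2^-1, C; split => // f fjn; split.
  have [_ le1] := easy f fjn.
  have := lee_wpmul2l (_ : (0 <= (2^-1)%:E :> \bar R)%E) le1.
  by rewrite muleA -EFinM mulVf// mul1e; apply; rewrite lee_fin.
have [loc1 _] := easy f fjn; move: fjn; rewrite jnE => -[_ /finite_norm[nu nu0 fnu]].
by rewrite fnu -EFinM; apply: H => //; rewrite fnu.
Qed.
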